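(* Let $n\ge5$. For every $\zeta\in\mathcal Z$: (i) the cluster coordinates $(x_1,\dots,x_{n-4},y_1,\dots,y_{n-4})_\zeta$ define a biregular isomorphism between $(\mathbb C^* )^{2n-8}$ and a Zariski open subset of $\mathcal F_n$; (ii) the coordinates $(x_1,\dots,x_{n-4},y_1,\dots,y_{n-4})_\zeta$ restrict to a bijection between $\mathbb R_{>0}^{2n-8}$ and $\mathcal F_n^0$.
   Context: Indices $(p,q)$ of a 2-frieze range over pairs in $\mathbb Z^2\cup(\mathbb Z+\tfrac12)^2$ with $p-q\ge -3$; the entries with $p-q=r$ form row $r$. A 2-frieze pattern satisfies the rule $$v_{p,q}=v_{p-\frac12,q-\frac12}\,v_{p+\frac12,q+\frac12}-v_{p-\frac12,q+\frac12}\,v_{p+\frac12,q-\frac12}$$ for all $(p,q)$ with $p-q\ge -2$. The algebraic 2-frieze $F(A_i,B_i)$, with $A_i,B_i$ ($i\in\mathbb Z$) independent formal variables, is the 2-frieze in which rows $-3$ and $-2$ consist of $0$'s, row $-1$ consists of $1$'s, $v_{i,i}=A_i$ and $v_{i-\frac12,i-\frac12}=B_i$ (row $0$), and the rows $r\ge1$ are determined by the rule in the field of rational functions; all its entries are polynomials in the $A_i,B_i$. The numerical 2-frieze $F(a_i,b_i)$ is the evaluation at $A_i=a_i$, $B_i=b_i$. $F(a_i,b_i)$ is closed of width $n-4$ if row $n-4$ consists of $1$'s and rows $n-3,n-2$ consist of $0$'s. In a closed 2-frieze of width $n-4$ one has $a_{i+n}=a_i$, $b_{i+n}=b_i$. $\mathcal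 F_n$ is the (complex) algebraic variety of all closed 2-friezes $F(a_i,b_i)$ of width $n-4$, viewed as a subvariety of $\mathbb C^{2n}$ with coordinates $(a_1,\dots,a_n,b_1,\dots,b_n)$; $\mathcal F_n^0\subset\mathcal F_n$ is the subset of those 2-friezes all of whose entries in rows $0,\dots,n-5$ (the rows between the two rows of $1$'s) are positive real numbers. Double zig-zags: a double zig-zag $\zeta$ is a choice, for each row $r=0,\dots,n-5$, of two adjacent entries of that row, $v_{p_r,\,p_r-r}$ and $v_{p_r+\frac12,\,p_r+\frac12-r}$ with $p_r\in\frac12\mathbb Z$, such that $p_{r+1}\in\{p_r,\;p_r+\tfrac12,\;p_r+1\}$ for all $r$ (the pair in the next row is directly underneath the pair above it, or is offset by one position to the left or to the right). $\mathcal Z$ is the set of all double zig-zags. For $\zeta\in\mathcal Z$, $x_{r+1}$ denotes the entry of the pair in row $r$ having integer indices, and $y_{r+1}$ the entry having half-integer indices; these $2n-8$ functions on $\mathcal F_n$ are the coordinates $(x_1,\dots,x_{n-4},y_1,\dots,y_{n-4})_\zeta$. *)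

(* Defs.v *)
From HB Require Import structures.
From mathcomp Require Import all_boot all_order all_algebra.
From mathcomp Require Import finmap.
From mathcomp Require Import boolp classical_sets functions reals.
From mathcomp Require Import complex.
From mathcomp Require Import (canonicals) mpoly.
From mathcomp Require Import monalg.

Set Implicit Arguments.
Unset Strict Implicit.
Unset Printing Implicit Defensive.

Import Order.TTheory GRing.Theory Num.Theory.
Local Open Scope classical_set_scope.
Local Open Scope ring_scope.

(* {malg R[{cmonom I}]} is the ring of polynomials over R in the (possibly    *)
(* infinite) family of commuting variables indexed by I; monalg provides it   *)
(* as a commutative ring only. Here it is shown to be an integral domain when *)
(* R is one, so that its field of fractions can be formed.                    *)
Section PolyIdomain.
Context (I : choiceType) (R : idomainType).
Local Notation P := {malg R[{cmonom I}]}.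

Section Restrict.
Variable s : seq I.

Definition cm2mnm (m : {cmonom I}) : mpoly.multinom (size s) :=
  mpoly.Multinom [tuple of map m (in_tuple s)].

Definition cm2mpoly (m : {cmonom I}) : mpoly.mpoly (size s) R :=
  mpoly.mpolyX R (cm2mnm m).

Lemma cm2mnmE m i :
  mpoly.fun_of_multinom (cm2mnm m) i = m (tnth (in_tuple s) i).
Proof. by rewrite /mpoly.fun_of_multinom /= tnth_map. Qed.

Lemma cm2mpoly_mmorphism : mmorphism cm2mpoly.
Proof.
split=> [x y|]; rewrite /cm2mpoly.
  rewrite -mpoly.mpolyXD; congr mpoly.mpolyX; apply/mpoly.mnmP=> i.
  by rewrite mpoly.mnmDE !cm2mnmE cmM.
rewrite -mpoly.mpolyX0; congr mpoly.mpolyX; apply/mpoly.mnmP=> i.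
by rewrite mpoly.mnm0E cm2mnmE cm1.
Qed.

HB.instance Definition _ :=
  isMultiplicative.Build {cmonom I} (mpoly.mpoly (size s) R) cm2mpoly
    cm2mpoly_mmorphism.

Lemma cm2mnm_inj (k m : {cmonom I}) :
  {subset finsupp k <= s} -> {subset finsupp m <= s} ->
  cm2mnm k = cm2mnm m -> k = m.
Proof.
move=> ks ms e; apply/eqP/cmP => i; case: (boolP (i \in s)) => [si|nsi].
  have lt : (index i s < size s)%N by rewrite index_mem.
  have := congr1 (fun u => mpoly.fun_of_multinom u (Ordinal lt)) e.
  by rewrite !cm2mnmE (tnth_nth i) /= nth_index // => ->.
rewrite !fsfun_dflt //.
- by apply: contra nsi => /ms.
- by apply: contra nsi => /ks.
Qed.

Definition restr (p : P) : mpoly.mpoly (size s) R :=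
  mmap (@mpoly.mpolyC (size s) R) cm2mpoly p.

Lemma restrM : {morph restr : p q / p * q}.
Proof. exact: (rmorphM (mmap (@mpoly.mpolyC (size s) R) cm2mpoly)). Qed.

Lemma restr_eq0 (p : P) :
  (forall m, m \in msupp p -> {subset finsupp m <= s}) ->
  restr p = 0 -> p = 0.
Proof.
move=> sub p0; apply/malgP => k; rewrite mcoeff0.
case: (boolP (k \in msupp p)) => [kp|]; last exact: mcoeff_outdom.
have : mpoly.mcoeff (cm2mnm k) (restr p) = 0 by rewrite p0 mpoly.mcoeff0.
rewrite /restr mmapE raddf_sum /= (big_fsetD1 k) //=.
rewrite mpoly.mcoeffCM mpoly.mcoeffX eqxx mulr1 big_seq big1 ?addr0 //.
move=> m; rewrite in_fsetD1 => /andP[nmk mp].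
rewrite mpoly.mcoeffCM mpoly.mcoeffX; case: eqP => [e|_]; last by rewrite mulr0.
by move: nmk; rewrite (cm2mnm_inj (sub _ mp) (sub _ kp) e) eqxx.
Qed.

End Restrict.

Lemma malg_idomainAxiom (p q : P) : p * q = 0 -> (p == 0) || (q == 0).
Proof.
move=> pq0.
pose s := flatten
  [seq (finsupp (m : {cmonom I}) : seq I)
     | m : {cmonom I} <- (msupp p : seq _) ++ msupp q].
have sub m : m \in (msupp p : seq _) ++ msupp q -> {subset finsupp m <= s}.
  move=> mpq i im; apply/flattenP; exists (enum_fset (finsupp m)) => //.
  exact: (map_f (fun m : {cmonom I} => finsupp m : seq I)).
have : restr s p * restr s q = 0.
  by rewrite -restrM pq0 /restr mmap0.
move/eqP; rewrite mulf_eq0 => /orP[] /eqP/restr_eq0 ->; rewrite ?eqxx ?orbT //.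
- by move=> m mp; apply: sub; rewrite mem_cat mp.
- by move=> m mp; apply: sub; rewrite mem_cat mp orbT.
Qed.

Definition malg_unit : pred P := fun p => `[< exists q, q * p = 1 >].

Definition malg_inv (p : P) : P := xget p [set q | q * p = 1].

Lemma malg_mulVp : {in malg_unit, left_inverse 1 malg_inv *%R}.
Proof. move=> p /asboolP pU; exact: (xgetPex p pU). Qed.

Lemma malg_intro_unit (p q : P) : q * p = 1 -> p \in malg_unit.
Proof. by move=> qp; apply/asboolP; exists q. Qed.

Lemma malg_inv_out : {in [predC malg_unit], malg_inv =1 id}.
Proof.
move=> p /asboolPn np; rewrite /malg_inv xgetPN // => y yp.
by apply: np; exists y.
Qed.

HB.instance Definition _ := GRing.ComRing_hasMulInverse.Build
  (malg {cmonom I} R) malg_mulVp malg_intro_unit malg_inv_out.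
HB.instance Definition _ := GRing.ComUnitRing_isIntegral.Build
  (malg {cmonom I} R) malg_idomainAxiom.

End PolyIdomain.

Definition peval (I : choiceType) (R : comNzRingType) (x : I -> R)
    (p : {malg R[{cmonom I}]}) : R :=
  mmap idfun (fun m : {cmonom I} => \prod_(i <- finsupp m) x i ^+ m i) p.

Section AlgebraicGeometry.
Context (K : fieldType).

Definition mveval (m : nat) (p : {malg K[{cmonom 'I_m}]}) (x : 'rV[K]_m) : K :=
  peval (x ord0) p.

Definition zariski_closed (m : nat) (Z : set 'rV[K]_m) : Prop :=
  exists S : set {malg K[{cmonom 'I_m}]},
    Z = [set x | forall p, S p -> mveval p x = 0].

Definition zariski_open_in (m : nat) (X U : set 'rV[K]_m) : Prop :=
  exists Z : set 'rV[K]_m, zariski_closed Z /\ U = X `\` Z.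

(* Near each point of X, f is a quotient of polynomials; the neighbourhood is *)
(* taken to be the nonvanishing locus of the denominator.                     *)
Definition regular_on (m : nat) (X : set 'rV[K]_m) (f : 'rV[K]_m -> K) : Prop :=
  forall x, X x -> exists p q : {malg K[{cmonom 'I_m}]},
    mveval q x != 0 /\
    forall y, X y -> mveval q y != 0 -> f y = mveval p y / mveval q y.

Definition morphism_on (m k : nat) (X : set 'rV[K]_m) (Y : set 'rV[K]_k)
    (f : 'rV[K]_m -> 'rV[K]_k) : Prop :=
  set_fun X Y f /\ forall j, regular_on X (fun x => f x ord0 j).

Definition biregular (m k : nat) (X : set 'rV[K]_m) (Y : set 'rV[K]_k)
    (f : 'rV[K]_m -> 'rV[K]_k) : Prop :=
  morphism_on X Y f /\
  exists g : 'rV[K]_k -> 'rV[K]_m,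
    [/\ morphism_on Y X g, {in X, cancel f g} & {in Y, cancel g f}].

Definition torus (m : nat) : set 'rV[K]_m := [set x | forall j, x ord0 j != 0].

End AlgebraicGeometry.

(* An index (p, q) with p - q = r is encoded by the row r and the doubled     *)
(* first index P = 2 p, so that both p and q = p - r are integers when P is   *)
(* even and half-integers when P is odd. In this encoding the frieze rule     *)
(* reads                                                                      *)
(*   v r P = v r (P - 1) * v r (P + 1) - v (r - 1) (P - 1) * v (r + 1) (P + 1)*)
Section Friezes.
Context (R : realType).
Local Notation C := R[i].

Definition frieze_var : choiceType := (int + int)%type.
Definition frieze_poly : idomainType := {malg C[{cmonom frieze_var}]}.
Definition frieze_field : fieldType := {fraction frieze_poly}.
Local Notation tofrac := (@FracField.tofrac frieze_poly).

Definition var_poly (v : frieze_var) : frieze_poly := << ucm v >>.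
Definition A_ (i : int) : frieze_field := tofrac (var_poly (inl i)).
Definition B_ (i : int) : frieze_field := tofrac (var_poly (inr i)).

Definition alg_row0 (P : int) : frieze_field :=
  if (2 %| P)%Z then A_ (P %/ 2)%Z else B_ ((P + 1) %/ 2)%Z.

(* Rows k - 1 and k of the algebraic 2-frieze. *)
Fixpoint alg_rows (k : nat) : (int -> frieze_field) * (int -> frieze_field) :=
  if k is k'.+1 then
    let: (u, v) := alg_rows k' in
    (v, fun P => (v (P - 2) * v P - v (P - 1)) / u (P - 2))
  else (fun=> 1, alg_row0).

Definition alg_entry (r P : int) : frieze_field :=
  match r with
  | Posz k => (alg_rows k).2 P
  | Negz 0 => 1
  | Negz _ => 0
  end.

(* Every entry is (the image of) a unique polynomial, so the default value is *)
(* never used.                                                                *)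
Definition entry_poly (r P : int) : frieze_poly :=
  xget 0 [set p : frieze_poly | tofrac p = alg_entry r P].

Definition num_entry (a b : int -> C) (r P : int) : C :=
  peval (fun v : frieze_var => match v with inl i => a i | inr i => b i end)
    (entry_poly r P).

(* Here and below the width is n - 4. *)
Definition closed_frieze (n : nat) (a b : int -> C) : Prop :=
  [/\ forall P, num_entry a b (n - 4)%N P = 1,
      forall P, num_entry a b (n - 3)%N P = 0
    & forall P, num_entry a b (n - 2)%N P = 0].

Definition positive_frieze (n : nat) (a b : int -> C) : Prop :=
  forall (r : 'I_(n - 4)) (P : int), 0 < num_entry a b r P.

(* The point (a_1, ..., a_n, b_1, ..., b_n). *)
Definition frieze_point (n : nat) (a b : int -> C) : 'rV[C]_(n + n) :=
  row_mx (\row_(i < n) a i.+1) (\row_(i < n) b i.+1).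

Definition friezes (n : nat) : set 'rV[C]_(n + n) :=
  [set x | exists a b, closed_frieze n a b /\ x = frieze_point n a b].

Definition pos_friezes (n : nat) : set 'rV[C]_(n + n) :=
  [set x | exists a b, [/\ closed_frieze n a b, positive_frieze n a b
                         & x = frieze_point n a b]].

(* The n-periodic sequence with u_1, ..., u_n given by the row vector u. *)
Definition periodic_seq (n : nat) (u : 'rV[C]_n) (i : int) : C :=
  oapp (u ord0) 0 (insub `|((i - 1) %% n)%Z|%N).

(* Entries as functions on [friezes n]: a closed 2-frieze of width n - 4 is   *)
(* n-periodic, hence recovered from its point in C^(2n).                      *)
Definition entry_at (n : nat) (x : 'rV[C]_(n + n)) (r P : int) : C :=
  num_entry (periodic_seq (lsubmx x)) (periodic_seq (rsubmx x)) r P.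

(* [zeta r] is the doubled first index of the left entry of the pair in row r,*)
(* which thus consists of the entries [zeta r] and [zeta r + 1].              *)
Definition double_zigzag (m : nat) (zeta : 'I_m -> int) : Prop :=
  forall r s : 'I_m, s = r.+1 :> nat ->
    zeta s \in [:: zeta r; zeta r + 1; zeta r + 2].

Definition x_index (P : int) : int := if (2 %| P)%Z then P else P + 1.
Definition y_index (P : int) : int := if (2 %| P)%Z then P + 1 else P.

(* The index r < n - 4 of a column is the row number, so column r of the left *)
(* (right) block holds x_(r+1) (y_(r+1)).                                     *)
Definition zigzag_coords (n : nat) (zeta : 'I_(n - 4) -> int)
    (x : 'rV[C]_(n + n)) : 'rV[C]_((n - 4) + (n - 4)) :=
  row_mx (\row_r entry_at x r (x_index (zeta r)))
         (\row_r entry_at x r (y_index (zeta r))).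

(* In the order of R[i], 0 < z means that z is real and positive. *)
Definition positive_orthant (m : nat) : set 'rV[C]_m :=
  [set z | forall j, 0 < z ord0 j].

End Friezes.

Arguments torus K m : clear implicits.
Arguments friezes R n : clear implicits.
Arguments pos_friezes R n : clear implicits.
Arguments positive_orthant R m : clear implicits.

(* Main.v *)
From HB Require Import structures.
Require Import Defs.
From mathcomp Require Import all_boot all_order all_algebra.
From mathcomp Require Import finmap.
From mathcomp Require Import boolp classical_sets functions reals.
From mathcomp Require Import complex.
From mathcomp Require Import monalg.
From mathcomp Require Import zify ring.

Set Implicit Arguments.
Unset Strict Implicit.
Unset Printing Implicit Defensive.

Import Order.TTheory GRing.Theory Num.Theory.
Local Open Scope ring_scope.

(** The idea is to read a 2-frieze as a polygon in three-space. Over a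
    commutative ring, call chain a sequence of vectors X m, m an integer, with
    X m x X (m + 2) = X (m + 1) and X m . X (m + 3) = 1: the even terms are the
    vertices of a polygon any three consecutive of which have determinant 1,
    and the odd terms are the cross products of consecutive vertices. The
    product X s . X t with t - s = 2 r + 5 is an entry of row r of a 2-frieze:
    the frieze rule is Lagrange's identity (chain_rule), rows -2 and -1 come
    from the definition, and row 0 can be prescribed (chain_exists). Since
    chains exist over polynomial rings, the entries of the algebraic frieze are
    polynomials, and those of F(a, b) are the products of a chain with row 0
    given by a and b (num_entry_chain). The frieze is closed of width n - 4
    exactly when the chain has period 2n (closed_friezeE).

    In this picture the pair of entries chosen by a double zigzag in one row is
    X lo . X (hi - 1), X (lo + 1) . X hi, for a window [lo, hi] of indices, and
    the step to the next row adds two terms to the window, on the left, on the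
    right, or one on each side. A new term X (b + 1) has to satisfy
    X (b - 1) x X (b + 1) = X b and to have a prescribed product with some
    earlier term X c. By the triple product formula these equations have exactly
    one solution as soon as X c . X (b - 1) is nonzero, and this product is
    always one of the two entries of the zigzag in the previous row. So,
    starting from a standard frame in the upper row of ones, nonzero
    coordinates determine one window after the other (window_unique), by
    formulas that divide only by coordinates (window_exists). The window of the
    lower row of ones has 2n - 1 terms and extends to a unique chain of period
    2n (chain_close, periodic_agree). Hence the coordinates are a bijection
    from the closed friezes on which they do not vanish to the torus, given by
    polynomials in one direction and by quotients of polynomials by monomials
    in the other.

    For positive coordinates, all entries are positive: to the right of the
    zigzag the frieze rule expresses each new entry by sums, products and
    quotients of previous ones, and a closed frieze is periodic (chain_pos). *)

(** * Vectors in three-space *)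

Section Vectors.
Context (R : comNzRingType).
Definition vec3 : Type := (R * R * R)%type.
Implicit Types (u v w x : vec3) (s t : R).

Definition dot u v : R := u.1.1 * v.1.1 + u.1.2 * v.1.2 + u.2 * v.2.
Definition cross u v : vec3 :=
  (u.1.2 * v.2 - u.2 * v.1.2, u.2 * v.1.1 - u.1.1 * v.2,
   u.1.1 * v.1.2 - u.1.2 * v.1.1).
Definition comb t u s v : vec3 :=
  (t * u.1.1 + s * v.1.1, t * u.1.2 + s * v.1.2, t * u.2 + s * v.2).

Definition e1 : vec3 := (1, 0, 0).
Definition e2 : vec3 := (0, 1, 0).
Definition e3 : vec3 := (0, 0, 1).

Lemma vec3P u v : u.1.1 = v.1.1 -> u.1.2 = v.1.2 -> u.2 = v.2 -> u = v.
Proof. by move: u v => [[? ?] ?] [[? ?] ?] /= -> -> ->. Qed.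

Lemma dotC u v : dot u v = dot v u.
Proof. rewrite /dot; ring. Qed.

Lemma dot_combr t s u v w : dot w (comb t u s v) = t * dot w u + s * dot w v.
Proof. rewrite /dot /=; ring. Qed.

Lemma cross_combr t s u v w :
  cross w (comb t u s v) = comb t (cross w u) s (cross w v).
Proof. apply: vec3P => /=; ring. Qed.

Lemma cross_combl t s u v w :
  cross (comb t u s v) w = comb t (cross u w) s (cross v w).
Proof. apply: vec3P => /=; ring. Qed.

Lemma dot_crossl u v : dot u (cross u v) = 0.
Proof. rewrite /dot /=; ring. Qed.

Lemma dot_crossr u v : dot v (cross u v) = 0.
Proof. rewrite /dot /=; ring. Qed.

Lemma dot_cross u v w : dot (cross u v) w = dot u (cross v w).
Proof. rewrite /dot /=; ring. Qed.

Lemma det_rot u v w : dot u (cross v w) = dot v (cross w u).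
Proof. rewrite /dot /=; ring. Qed.

Lemma cross_crossl u v w :
  cross (cross u v) w = comb (dot u w) v (- dot v w) u.
Proof. apply: vec3P; rewrite /dot /=; ring. Qed.

Lemma cross_crossr u v w :
  cross w (cross u v) = comb (dot v w) u (- dot u w) v.
Proof. apply: vec3P; rewrite /dot /=; ring. Qed.

Lemma dot_cross2 u v w x :
  dot (cross u v) (cross w x) = dot u w * dot v x - dot u x * dot v w.
Proof. rewrite /dot /=; ring. Qed.

Lemma cramer u v w x : dot u (cross v w) = 1 ->
  x = comb 1 (comb (dot (cross v w) x) u (dot (cross w u) x) v)
        (dot (cross u v) x) w.
Proof.
move=> d; transitivity (comb (dot u (cross v w)) x 0 x).
  by rewrite d; apply: vec3P => /=; ring.
by apply: vec3P; rewrite /dot /=; ring.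
Qed.

(** The three products of x with a basis are its coordinates in the dual basis
    v x w, w x u, u x v, which has determinant 1 as well. *)
Lemma dot_inj u v w x y : dot u (cross v w) = 1 ->
  dot u x = dot u y -> dot v x = dot v y -> dot w x = dot w y -> x = y.
Proof.
move=> d hu hv hw.
have dd : dot (cross v w) (cross (cross w u) (cross u v)) = 1.
  rewrite dot_cross2 -[RHS](mulr1 1) -{1}d -d /dot /=; ring.
have E (f g : vec3) z :
    cross (cross f g) (cross g z) = comb (dot f (cross g z)) g 0 g.
  by apply: vec3P; rewrite /dot /=; ring.
rewrite (cramer x dd) (cramer y dd) !E; congr comb; first congr comb;
  by rewrite !(dotC (comb _ _ _ _)) !dot_combr !mul0r !addr0 ?(dotC x)
    ?(dotC y) ?hu ?hv ?hw.
Qed.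
End Vectors.

(** * Chains *)

(** Two-sided iteration: the invertibility of F m on the invariant I is what
    lets the orbit be continued to the left. *)
Lemma int_orbit (T : Type) (I : T -> Prop) (F G : int -> T -> T) (s : int)
    (x0 : T) :
  (forall m x, I x -> I (F m x)) ->
  (forall m x, I x -> I (G m x) /\ F m (G m x) = x) -> I x0 ->
  exists S : int -> T, S s = x0 /\ forall m, I (S m) /\ S (m + 1) = F m (S m).
Proof.
move=> IF IG I0.
pose up := fix up (k : nat) : T :=
  if k is k'.+1 then F (s + k'%:Z) (up k') else x0.
pose dn := fix dn (k : nat) : T :=
  if k is k'.+1 then G (s - k'.+1%:Z) (dn k') else x0.
have Iup k : I (up k) by elim: k => //= k; apply: IF.
have Idn k : I (dn k) by elim: k => //= k /IG-/(_ (s - k.+1%:Z))[].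
pose S (m : int) := if s <= m then up (absz (m - s)%R) else dn (absz (m - s)%R).
exists S; split=> [|m]; first by rewrite /S lexx subrr.
split; first by rewrite /S; case: ifP.
rewrite /S; case: (lerP s m) => sm.
  have -> : s <= m + 1 by lia.
  have -> : absz (m + 1 - s)%R = (absz (m - s)%R).+1 by lia.
  by rewrite /=; congr F; lia.
have -> : absz (m - s)%R = (absz (m + 1 - s)%R).+1 by lia.
have e : s - ((absz (m + 1 - s)%R).+1)%:Z = m by lia.
rewrite /= e (IG _ _ (Idn _)).2; case: ifP => // sm1.
by have -> : absz (m + 1 - s)%R = 0%N by lia.
Qed.

Section Chains.
Context (R : comNzRingType).
Implicit Types (X Y : int -> vec3 R) (c : int -> R) (m s P : int).

(** A chain interleaves the vectors of a polygon (even indices, say) with the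
    cross products of consecutive ones (odd indices). Both parities play the
    same role: (u x v) x (v x w) = v when det (u, v, w) = 1. *)
Definition chain_on (a b : int) X : Prop :=
  (forall m, a <= m -> m + 2 <= b -> cross (X m) (X (m + 2)) = X (m + 1)) /\
  (forall m, a <= m -> m + 3 <= b -> dot (X m) (X (m + 3)) = 1).

Definition is_chain X : Prop := forall a b, chain_on a b X.

(** The index k counts rows from the row of ones above the frieze, so this is
    the entry of row k - 1 with doubled first index P. *)
Definition entry X (k : nat) P : R := dot (X (P - k.*2%:Z - 3)) (X P).

(** Chains with the same entries differ by an element of SL_3; a frame selects
    one of them. *)
Definition framed s X : Prop :=
  [/\ X s = e1 R, X (s + 2) = e2 R & X (s + 4) = e3 R].

Lemma is_chainP X :
  (forall m, cross (X m) (X (m + 2)) = X (m + 1)) ->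
  (forall m, dot (X m) (X (m + 3)) = 1) -> is_chain X.
Proof. by move=> h1 h2 a b; split=> *; auto. Qed.

Lemma chain_cross X m p q : is_chain X -> p = m + 1 -> q = m + 2 ->
  cross (X m) (X q) = X p.
Proof. move=> h -> ->; apply: (h m (m + 2)).1; lia. Qed.

Lemma chain_dot3 X m q : is_chain X -> q = m + 3 -> dot (X m) (X q) = 1.
Proof. move=> h ->; apply: (h m (m + 3)).2; lia. Qed.

Lemma chain_dot1 X m q : is_chain X -> q = m + 1 -> dot (X m) (X q) = 0.
Proof.
move=> h ->; rewrite -(@chain_cross X m (m + 1) (m + 2)) //; exact: dot_crossl.
Qed.

Lemma chain_det X m p q : is_chain X -> p = m + 2 -> q = m + 4 ->
  dot (X m) (cross (X p) (X q)) = 1.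
Proof.
move=> h -> ->; rewrite (@chain_cross X _ (m + 3)) //; try lia.
exact: chain_dot3.
Qed.

(** The prescribed row 0 gives the coefficients of a linear recurrence of order
    six for X, hence a polynomial construction over any commutative ring. It
    is run on the triples (X m, X (m + 2), X (m + 4)), whose determinant stays
    equal to 1; going back is possible because the recurrence reads the same
    in both directions. *)
Lemma chain_exists c s : exists X, [/\ is_chain X, framed s X &
  forall P, dot (X (P - 5)) (X P) = c P].
Proof.
pose I (t : vec3 R * vec3 R * vec3 R) := dot t.1.1 (cross t.1.2 t.2) = 1.
pose F m (t : vec3 R * vec3 R * vec3 R) :=
  (cross t.1.1 t.1.2, cross t.1.2 t.2,
   comb (c (m + 5)) (cross t.1.2 t.2) 1 (cross t.2 t.1.1)).
pose G m (t : vec3 R * vec3 R * vec3 R) :=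
  (comb (c (m + 5)) (cross t.1.1 t.1.2) 1 (cross t.2 t.1.1),
   cross t.1.1 t.1.2, cross t.1.2 t.2).
have sq (u v w : vec3 R) : dot u (cross v w) = 1 ->
    dot (cross u v) (cross (cross v w) (cross w u)) = 1.
  move=> h; rewrite cross_crossr dot_combr dot_crossr dot_cross h.
  by rewrite oppr0 mul0r addr0 mulr1.
have E (u v w : vec3 R) : dot u (cross v w) = 1 ->
  cross (cross u v) (cross v w) = v.
  move=> h; rewrite cross_crossl h dot_crossl.
  by apply: vec3P => /=; ring.
have IF m t : I t -> I (F m t).
  move: t => [[u v] w]; rewrite /I /= => h.
  rewrite cross_combr dot_combr sq // mulr1.
  by rewrite (_ : cross (cross v w) (cross v w) = comb 0 u 0 u);
    [rewrite dot_combr|apply: vec3P => /=]; ring.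
have IG m t : I t -> I (G m t) /\ F m (G m t) = t.
  move: t => [[u v] w]; rewrite /I /F /G /= => h.
  rewrite E //; split.
    by rewrite dotC dot_combr dot_crossr -det_rot h mulr0 add0r mulr1.
  have -> : cross (comb (c (m + 5)) (cross u v) 1 (cross w u)) (cross u v) = u.
    rewrite cross_combl (E w u v); last by rewrite det_rot.
    by apply: vec3P => /=; ring.
  congr (_, _, _); rewrite cross_combr (E v w u); last by rewrite -det_rot.
  have -> : cross (cross v w) (cross u v) = comb (- 1) v 0 v.
    rewrite -[in comb _ v](E u v w h); apply: vec3P => /=; ring.
  by apply: vec3P => /=; ring.
have I0 : I (e1 R, e2 R, e3 R) by rewrite /I /dot /=; ring.
have [S [S0 HS]] := int_orbit s IF IG I0.
have [X def_X] : {X : int -> vec3 R | forall m, X m = (S m).1.1}.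
  by exists (fun m => (S m).1.1).
have X1 m : X (m + 1) = cross (S m).1.1 (S m).1.2 by rewrite def_X (HS m).2.
have B m : X (m + 2) = (S m).1.2.
  have -> : m + 2 = m + 1 + 1 by lia.
  by rewrite X1 (HS m).2 /= E //; exact: (HS m).1.
have X3 m : X (m + 3) = cross (S m).1.2 (S m).2.
  have -> : m + 3 = m + 1 + 2 by lia.
  by rewrite B (HS m).2.
have X4 m : X (m + 4) = (S m).2.
  have -> : m + 4 = m + 1 + 3 by lia.
  rewrite X3 (HS m).2 /= cross_combr (E _ _ (S m).1.1); last first.
    by rewrite -det_rot; exact: (HS m).1.
  by apply: vec3P => /=; ring.
exists X; split.
- apply: is_chainP => m; first by rewrite B X1 def_X.
  by rewrite X3 def_X; exact: (HS m).1.
- by split; rewrite ?B ?X4 ?def_X S0.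
move=> P; have := X4 (P - 5 + 1); rewrite (_ : P - 5 + 1 + 4 = P); last by lia.
move=> ->; rewrite (HS _).2 /= dot_combr def_X (HS _).1.
by rewrite dot_crossr (_ : P - 5 + 5 = P); [ring|lia].
Qed.

(** Expansion of X (m + 6) in the basis X m, X (m + 2), X (m + 4), paired with
    an arbitrary term of the chain. *)
Lemma chain_rec X m p2 p4 p6 p5 p1 (s : int) : is_chain X ->
  p2 = m + 2 -> p4 = m + 4 -> p6 = m + 6 -> p5 = m + 5 -> p1 = m + 1 ->
  dot (X s) (X p6) = dot (X p1) (X p6) * dot (X s) (X p4)
    - dot (X m) (X p5) * dot (X s) (X p2) + dot (X s) (X m).
Proof.
move=> h -> -> -> -> ->.
have rot (u w x : vec3 R) : dot (cross w u) x = - dot u (cross w x).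
  by rewrite /dot /=; ring.
have d := chain_det h (erefl (m + 2)) (erefl (m + 4)).
rewrite [in LHS](cramer (X (m + 6)) d) (rot _ (X (m + 4))).
rewrite (@chain_cross X (m + 2) (m + 3)) //; [|lia..].
rewrite (@chain_cross X (m + 4) (m + 5)) //; [|lia..].
rewrite (@chain_cross X m (m + 1)) // (@chain_dot3 X (m + 3)) //; last by lia.
by rewrite !dot_combr; ring.
Qed.

(** The frieze rule: the 2 x 2 minor of products of X m, X (m + 2) with X P,
    X (P + 2) is, by Lagrange's identity, the product of X (m + 1) with
    X (P + 1). *)
Lemma chain_rule X k P : is_chain X ->
  entry X k.+1 P * entry X k.+1 (P + 2) =
  entry X k.+1 (P + 1) + entry X k P * entry X k.+2 (P + 2).
Proof.
move=> h; rewrite /entry.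
have -> : P + 1 - (k.+1).*2%:Z - 3 = P - (k.+1).*2%:Z - 3 + 1 by lia.
have -> : P + 2 - (k.+1).*2%:Z - 3 = P - (k.+1).*2%:Z - 3 + 2 by lia.
have -> : P + 2 - (k.+2).*2%:Z - 3 = P - (k.+1).*2%:Z - 3 by lia.
have -> : P - k.*2%:Z - 3 = P - (k.+1).*2%:Z - 3 + 2 by lia.
set m := P - (k.+1).*2%:Z - 3.
rewrite -(@chain_cross X m (m + 1) (m + 2)) //.
rewrite -(@chain_cross X P (P + 1) (P + 2)) //.
rewrite dot_cross2; ring.
Qed.

Lemma entry0 X P : is_chain X -> entry X 0 P = 1.
Proof. by move=> h; apply: chain_dot3 => //; lia. Qed.

Lemma entry1 X P : entry X 1 P = dot (X (P - 5)) (X P).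
Proof. by rewrite /entry; congr (dot (X _) _); lia. Qed.

Lemma entry_rec X k P : is_chain X ->
  entry X k.+3 (P + 6) = entry X 1 (P + 6) * entry X k.+2 (P + 4)
    - entry X 1 (P + 5) * entry X k.+1 (P + 2) + entry X k P.
Proof.
move=> h; rewrite !entry1 /entry.
rewrite (@chain_rec X P (P + 2) (P + 4) (P + 6) (P + 5) (P + 1)) //.
have -> : P + 6 - 5 = P + 1 by lia.
have -> : P + 5 - 5 = P by lia.
have -> : P + 6 - k.+3.*2%:Z - 3 = P - k.*2%:Z - 3 by lia.
have -> : P + 4 - k.+2.*2%:Z - 3 = P - k.*2%:Z - 3 by lia.
by have -> : P + 2 - k.+1.*2%:Z - 3 = P - k.*2%:Z - 3 by lia.
Qed.

Lemma entry_2 X P : is_chain X ->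
  entry X 2 P = entry X 1 P * entry X 1 (P - 2) - entry X 1 (P - 1).
Proof.
move=> h; rewrite {1}/entry.
rewrite (@chain_rec X (P - 6) (P - 4) (P - 2) P (P - 1) (P - 5)) //; try lia.
rewrite (_ : P - 2.*2%:Z - 3 = (P - 6) - 1); last by lia.
rewrite (@chain_dot1 X (P - 6 - 1) (P - 6)) //; last by lia.
rewrite (@chain_dot3 X (P - 6 - 1) (P - 4)) //; last by lia.
rewrite !entry1 (_ : P - 2 - 5 = P - 6 - 1); last by lia.
rewrite (_ : P - 1 - 5 = P - 6); last by lia.
ring.
Qed.

(** Unlike the frieze rule, the linear recurrence determines the entries from
    row 0 without any division. *)
Lemma entry_ext X Y k P : is_chain X -> is_chain Y ->
  (forall P, entry X 1 P = entry Y 1 P) -> entry X k P = entry Y k P.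
Proof.
move=> hX hY e1.
suff : forall P, [/\ entry X k P = entry Y k P,
   entry X k.+1 P = entry Y k.+1 P & entry X k.+2 P = entry Y k.+2 P].
  by move=> /(_ P)[].
elim: k {P} => [|k IH] P.
  by split=> //; rewrite ?entry0 ?entry_2 // !e1.
have [_ ? ?] := IH P; split=> //.
rewrite (_ : P = P - 6 + 6); last by lia.
rewrite !entry_rec // !e1.
by have [-> _ _] := IH (P - 6); have [_ -> _] := IH (P - 6 + 2);
  have [_ _ ->] := IH (P - 6 + 4).
Qed.
End Chains.

(** * Closed chains *)

Section ChainMap.
Context (R S : comNzRingType) (f : {rmorphism R -> S}).
Definition vec3_map (u : vec3 R) : vec3 S := (f u.1.1, f u.1.2, f u.2).

Lemma dot_map u v : dot (vec3_map u) (vec3_map v) = f (dot u v).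
Proof. by rewrite /dot /= !rmorphD !rmorphM. Qed.

Lemma cross_map u v : cross (vec3_map u) (vec3_map v) = vec3_map (cross u v).
Proof. by rewrite /cross /vec3_map /= !rmorphB !rmorphM. Qed.

Lemma chain_map X : is_chain X -> is_chain (fun m => vec3_map (X m)).
Proof.
move=> h; apply: is_chainP => m.
  by rewrite cross_map (@chain_cross _ X m (m + 1)).
by rewrite dot_map (chain_dot3 h) // rmorph1.
Qed.

Lemma entry_map X k P : entry (fun m => vec3_map (X m)) k P = f (entry X k P).
Proof. exact: dot_map. Qed.
End ChainMap.

Section Periodic.
Context (R : comNzRingType).
Implicit Types (X Y : int -> vec3 R) (m s P : int).

(** The rows 1, 0, 0 say that X (m + 2n) has the same products as X m with the
    basis X (m - 1), X (m + 1), X (m + 3). *)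
Lemma closed_periodic N X : is_chain X ->
  (forall P, entry X N P = 1) -> (forall P, entry X N.+1 P = 0) ->
  (forall P, entry X N.+2 P = 0) -> forall m, X (m + N.+3.*2%:Z) = X m.
Proof.
move=> h c1 c2 c3 m.
have d : dot (X (m - 1)) (cross (X (m + 1)) (X (m + 3))) = 1.
  by apply: chain_det => //; lia.
apply: (dot_inj d).
- have := c3 (m + N.+3.*2%:Z); rewrite /entry.
  rewrite (_ : _ - 3 = m - 1); last by lia.
  by move=> ->; rewrite (chain_dot1 h) //; lia.
- have := c2 (m + N.+3.*2%:Z); rewrite /entry.
  rewrite (_ : _ - 3 = m + 1); last by lia.
  by move=> ->; rewrite dotC (chain_dot1 h) //; lia.
have := c1 (m + N.+3.*2%:Z); rewrite /entry.
rewrite (_ : _ - 3 = m + 3); last by lia.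
by move=> ->; rewrite dotC (chain_dot3 h) //; lia.
Qed.

Lemma periodic_closed N X : is_chain X ->
  (forall m, X (m + N.+3.*2%:Z) = X m) -> forall P,
  [/\ entry X N P = 1, entry X N.+1 P = 0 & entry X N.+2 P = 0].
Proof.
move=> h per P; rewrite /entry.
split.
- rewrite -(per (P - N.*2%:Z - 3)) dotC (chain_dot3 h) //; lia.
- rewrite -(per (P - N.+1.*2%:Z - 3)) dotC (chain_dot1 h) //; lia.
- rewrite -(per (P - N.+2.*2%:Z - 3)) (chain_dot1 h) //; lia.
Qed.

Lemma periodicZ (T : Type) (X : int -> T) (N : nat) :
  (forall m, X (m + N%:Z) = X m) -> forall m (z : int), X (m + N%:Z * z) = X m.
Proof.
move=> per; have pn m (k : nat) : X (m + N%:Z * k%:Z) = X m.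
  elim: k => [|k IH]; first by congr X; lia.
  by rewrite -IH -[RHS]per; congr X; lia.
move=> m [k|k]; first exact: pn.
by rewrite -(pn _ k.+1); congr X; rewrite NegzE; ring.
Qed.

(** The 2n-periodic extension of 2n - 1 consecutive terms, where n = N + 3: the
    missing term must be the cross product of its two neighbours. *)
Definition close_up N (a b : int) X m : vec3 R :=
  let r := a + ((m - a) %% N.+3.*2%:Z)%Z in
  if r <= b then X r else cross (X b) (X a).

(** The two entries 1 at the ends of [a, b] are the conditions that the new term
    and the periodicity impose. *)
Lemma chain_close N X (a b : int) : b = a + N.+2.*2%:Z -> chain_on a b X ->
  dot (X a) (X (b - 1)) = 1 -> dot (X (a + 1)) (X b) = 1 ->
  let Y := close_up N a b X in
  [/\ is_chain Y, forall m, Y (m + N.+3.*2%:Z) = Y m &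
    forall m, a <= m <= b -> Y m = X m].
Proof.
move=> eb [h1 h2] d1 d2; rewrite /close_up.
have [p ep] : exists p, p = N.+3.*2%:Z by exists N.+3.*2%:Z.
rewrite -ep; have p0 : p != 0 by lia.
(* W prolongs X over one period and three more indices, so that each condition
   on the periodic extension Y is a condition inside the range of W. *)
pose W m := if m <= b then X m else if m == b + 1 then cross (X b) (X a)
  else X (m - p).
set Y := fun m => _.
have mb m : 0 <= ((m - a) %% p)%Z < p.
  by rewrite modz_ge0 //= ltz_pmod //; lia.
have YE m : Y m = W (a + ((m - a) %% p)%Z).
  rewrite /Y /W; case: ifP => // nb; case: eqP => //; have := mb m; lia.
have perY m : Y (m + p) = Y m.
  by rewrite !YE (_ : m + p - a = 1 * p + (m - a)) ?modzMDl //; lia.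
have W0 m : m <= b -> W m = X m by rewrite /W => ->.
have W1 : W (b + 1) = cross (X b) (X a).
  by rewrite /W (_ : b + 1 <= b = false) ?eqxx //; lia.
have W2 m : b + 2 <= m -> W m = X (m - p).
  move=> hm; rewrite /W (_ : m <= b = false); last by lia.
  by rewrite (_ : (m == b + 1) = false) //; lia.
have YW m : a <= m <= b + 4 -> Y m = W m.
  move=> hm; rewrite YE; case: (lerP m (b + 1)) => hb.
    by rewrite modz_small; [congr W|]; lia.
  rewrite [RHS]W2; last by lia.
  rewrite (_ : m - a = 1 * p + (m - p - a)); last by lia.
  rewrite modzMDl modz_small; last by lia.
  by rewrite addrC subrK W0 //; lia.
have Xc m q r : a <= m -> q <= b -> q = m + 2 -> r = m + 1 ->
    cross (X m) (X q) = X r.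
  by move=> ? ? eq ->; rewrite eq h1 // -eq.
have d3 : dot (X (b - 1)) (X b) = 0.
  rewrite -(Xc (b - 2) b (b - 1)); [|lia..].
  by rewrite dotC dot_crossr.
have d4 : dot (X a) (X (a + 1)) = 0.
  by rewrite -(Xc a (a + 2) (a + 1)); rewrite ?dot_crossl //; lia.
have Wm m q r : b - 3 < m -> m < b + 3 -> q = m + 2 -> r = m + 1 ->
    cross (W m) (W q) = W r.
  move=> hm hm'.
  have [->|[->|[->|[->|->]]]] :
    m = b - 2 \/ m = b - 1 \/ m = b \/ m = b + 1 \/ m = b + 2 by lia.
  - by move=> *; rewrite !W0; try apply: Xc; lia.
  - move=> -> ->; rewrite (_ : b - 1 + 2 = b + 1) ?W1 ?subrK ?W0 //; try lia.
    rewrite cross_crossr d1 (dotC (X b)) d3; apply: vec3P => /=; ring.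
  - by move=> -> ->; rewrite W0 // W1 (W2 (b + 2)) // (_ : b + 2 - p = a) //; lia.
  - move=> -> ->; rewrite W1 !W2; try lia.
    rewrite (_ : b + 1 + 2 - p = a + 1); last by lia.
    rewrite (_ : b + 1 + 1 - p = a); last by lia.
    rewrite cross_crossl d4 (dotC (X b)) d2; apply: vec3P => /=; ring.
  move=> -> ->; rewrite !W2; try lia.
  rewrite (_ : b + 2 - p = a); last by lia.
  by apply: Xc; lia.
have Wd m q : a <= m -> m < a + p -> q = m + 3 -> dot (W m) (W q) = 1.
  move=> am mp ->; case: (lerP (m + 3) b) => hm; first by rewrite !W0 ?h2 //; lia.
  have [e|[e|[e|e]]] : m = b - 2 \/ m = b - 1 \/ m = b \/ m = b + 1 by lia.
  - rewrite {}e (_ : b - 2 + 3 = b + 1) ?W1 ?W0 //; try lia.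
    by rewrite -dot_cross (Xc _ _ (b - 1)) 1?dotC //; lia.
  - rewrite {}e W0 ?W2; try lia.
    by rewrite (_ : b - 1 + 3 - p = a) 1?dotC //; lia.
  - rewrite {}e W0 ?W2; try lia.
    by rewrite (_ : b + 3 - p = a + 1) 1?dotC //; lia.
  rewrite {}e W1 W2; last by lia.
  rewrite (_ : b + 1 + 3 - p = a + 2); last by lia.
  by rewrite dot_cross (Xc _ _ (a + 1)) 1?dotC //; lia.
have YY m : exists2 m0, a <= m0 < a + p &
    forall j, 0 <= j <= 3 -> Y (m + j) = W (m0 + j).
  exists (a + ((m - a) %% p)%Z) => [|j hj]; first by have := mb m; lia.
  rewrite -YW; last by have := mb m; lia.
  have := divz_eq (m - a) p; set z := (_ %/ p)%Z; set w := (_ %% p)%Z => e.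
  rewrite (_ : m + j = a + w + j + N.+3.*2%:Z * z); last first.
    by rewrite -ep mulrC; lia.
  by rewrite periodicZ // => x; rewrite -ep perY.
split.
- apply: is_chainP => m; have [m0 hm0 E] := YY m.
    have /= := E 0; rewrite !addr0 => -> //; rewrite !E //.
    case: (lerP (m0 + 2) b) => hm; first by rewrite !W0; try apply: Xc; lia.
    by apply: Wm; lia.
  have /= := E 0; rewrite !addr0 => -> //; rewrite !E //.
  by apply: Wd; lia.
- exact: perY.
- by move=> m hm; rewrite -(W0 m); [apply: YW|]; lia.
Qed.

(** Of the 2n terms of a period, the one outside [a, b] is the cross product of
    its neighbours. *)
Lemma periodic_agree N (a b : int) X Y : b = a + N.+2.*2%:Z ->
  is_chain X -> is_chain Y ->
  (forall m, X (m + N.+3.*2%:Z) = X m) -> (forall m, Y (m + N.+3.*2%:Z) = Y m) ->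
  (forall m, a <= m <= b -> X m = Y m) -> X =1 Y.
Proof.
move=> eb hX hY pX pY e m.
have [p ep] : exists p, p = N.+3.*2%:Z by exists N.+3.*2%:Z.
have mb : 0 <= ((m - a) %% p)%Z < p.
  by rewrite modz_ge0 ?ltz_pmod //; lia.
have := divz_eq (m - a) p; set z := (_ %/ p)%Z; set w := (_ %% p)%Z => em.
rewrite (_ : m = a + w + N.+3.*2%:Z * z); last first.
  by rewrite -ep mulrC; lia.
rewrite !periodicZ //; have [wb|wb] : a + w <= b \/ a + w = b + 1.
- by have : 0 <= w < p by []; lia.
- by apply: e; have : 0 <= w < p by []; lia.
rewrite wb -(@chain_cross _ X b _ (b + 2)) // -(@chain_cross _ Y b _ (b + 2)) //.
have -> : b + 2 = a + N.+3.*2%:Z by lia.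
by rewrite pX pY !e //; lia.
Qed.
End Periodic.

(** * Windows along a double zigzag *)

Section Zigzag.
Context (Z : nat -> int).
Hypothesis ZP : forall k, Z k <= Z k.+1 <= Z k + 2.
(** The pair of entries selected in row k - 1, of doubled first indices Z k and
    Z k + 1, consists of the two products that can be formed from the ends of
    the window [lo k, hi k] of a chain. *)
Definition lo (k : nat) : int := Z k - k.*2%:Z - 3.
Definition hi (k : nat) : int := Z k + 1.

Lemma window_mono j k : (j <= k)%N -> lo k <= lo j /\ hi j <= hi k.
Proof.
elim: k => [|k IH]; first by rewrite leqn0 => /eqP ->.
rewrite leq_eqVlt ltnS => /orP[/eqP ->//|/IH[]].
by have := ZP k; rewrite /lo /hi; lia.
Qed.

Lemma entry_lo (R : comNzRingType) (X : int -> vec3 R) k :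
  entry X k (Z k) = dot (X (lo k)) (X (hi k - 1)).
Proof. by rewrite /entry /lo /hi addrK. Qed.

Lemma entry_hi (R : comNzRingType) (X : int -> vec3 R) k :
  entry X k (Z k + 1) = dot (X (lo k + 1)) (X (hi k)).
Proof. by rewrite /entry /lo /hi; congr (dot (X _) _); lia. Qed.

(** The three possible offsets of the next pair add two terms to the window: on
    the left, one on each side, or on the right. *)
Lemma window_step k :
  [\/ lo k.+1 = lo k - 2 /\ hi k.+1 = hi k,
      lo k.+1 = lo k - 1 /\ hi k.+1 = hi k + 1 |
      lo k.+1 = lo k /\ hi k.+1 = hi k + 2].
Proof.
have := ZP k; rewrite /lo /hi => zk.
have [e|[e|e]] : Z k.+1 = Z k \/ Z k.+1 = Z k + 1 \/ Z k.+1 = Z k + 2 by lia.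
- by apply: Or31; lia.
- by apply: Or32; lia.
- by apply: Or33; lia.
Qed.

Lemma window_size k : hi k = lo k + k.*2%:Z + 4.
Proof. by rewrite /lo /hi; lia. Qed.

Section Uniqueness.
Context (K : fieldType).
Implicit Types X Y : int -> vec3 K.

(** By the triple product formula, (y x x) x p = (p . y) x - (p . x) y. *)
Lemma cross_inj (p x x' y z : vec3 K) : cross y x = z -> cross y x' = z ->
  dot p x = dot p x' -> dot p y != 0 -> x = x'.
Proof.
move=> xz xz' px py.
have E w : cross y w = z ->
    comb (dot p y) w 0 w = comb (dot p w) y 1 (cross z p).
  by move=> <-; rewrite cross_crossl !(dotC p); apply: vec3P => /=; ring.
have := E _ xz; rewrite px -E // => -[] /=.
by rewrite !mul0r !addr0 => *; apply: vec3P; exact: (mulfI py).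
Qed.

Definition agree a b X Y := forall m, a <= m <= b -> X m = Y m.

Lemma agree_right a b c d X Y : chain_on a d X -> chain_on a d Y ->
  a < b -> d = b + 1 -> a <= c <= b -> agree a b X Y ->
  dot (X c) (X d) = dot (Y c) (Y d) -> dot (X c) (X (b - 1)) != 0 ->
  agree a d X Y.
Proof.
move=> [hX _] [hY _] ab ed cb e hd nz m hm.
have [hb|-> {m hm}] : m <= b \/ m = d by lia.
  by apply: e; lia.
apply: (@cross_inj (X c) _ _ (X (b - 1)) (X b)) => //.
- have := hX (b - 1); rewrite (_ : b - 1 + 2 = d) ?subrK; last by lia.
  by apply; lia.
- have := hY (b - 1); rewrite (_ : b - 1 + 2 = d) ?subrK; last by lia.
  by rewrite -(e (b - 1)) -?(e b); [|lia..]; apply; lia.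
- by rewrite hd e.
Qed.

Lemma agree_left a b c d X Y : chain_on d b X -> chain_on d b Y ->
  a < b -> d = a - 1 -> a <= c <= b -> agree a b X Y ->
  dot (X d) (X c) = dot (Y d) (Y c) -> dot (X (a + 1)) (X c) != 0 ->
  agree d b X Y.
Proof.
move=> [hX _] [hY _] ab ed cb e hd nz m hm.
have [hb|-> {m hm}] : a <= m \/ m = d by lia.
  by apply: e; lia.
have antisym (u v w : vec3 K) : cross u v = w -> cross v u = comb (- 1) w 0 w.
  by move=> <-; apply: vec3P => /=; ring.
apply: (@cross_inj (X c) _ _ (X (a + 1)) (comb (- 1) (X a) 0 (X a))) => //.
- have := hX d; rewrite (_ : d + 2 = a + 1); last by lia.
  rewrite (_ : d + 1 = a); last by lia.
  by move=> hh; apply: antisym; apply: hh => //; lia.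
- have := hY d; rewrite (_ : d + 2 = a + 1); last by lia.
  rewrite (_ : d + 1 = a); last by lia.
  rewrite -(e (a + 1)) -?(e a); [|lia..] => hh; apply: antisym; apply: hh; lia.
- by rewrite dotC hd e // dotC.
- by rewrite dotC.
Qed.

(** The hypothesis of the two one-term extensions, that a product of the
    previous window is nonzero, is each time one of the entries on the zigzag. *)
Lemma window_unique N X Y :
  chain_on (lo N) (hi N) X -> chain_on (lo N) (hi N) Y ->
  agree (lo 0) (hi 0) X Y ->
  (forall k, (k <= N)%N ->
    [/\ entry X k (Z k) != 0, entry X k (Z k + 1) != 0,
     entry X k (Z k) = entry Y k (Z k) &
     entry X k (Z k + 1) = entry Y k (Z k + 1)]) ->
  agree (lo N) (hi N) X Y.
Proof.
move=> hX hY e0 he.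
have sub (W : int -> vec3 K) a b : lo N <= a -> b <= hi N ->
    chain_on (lo N) (hi N) W -> chain_on a b W.
  by move=> ? ? [h1 h2]; split=> m ? ?; [apply: h1|apply: h2]; lia.
suff : forall k, (k <= N)%N -> agree (lo k) (hi k) X Y by apply.
elim=> // k IH kN; have {IH} := IH (ltnW kN).
have [+ + _ _] := he k (ltnW kN); have [_ _] := he k.+1 kN.
rewrite !entry_lo !entry_hi => p1 q1 p q e.
have [lN hN] := window_mono kN; have sz := window_size k.
have [[el eh]|[el eh]|[el eh]] := window_step k;
  rewrite {}el {}eh in lN hN p1 q1 *.
- have e1 : agree (lo k - 1) (hi k) X Y.
    apply: (agree_left (c := hi k) _ _ _ _ _ e) => //;
      try (apply: sub => //); try lia.
    by move: q1; rewrite (_ : lo k - 2 + 1 = lo k - 1) //; lia.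
  apply: (agree_left (c := hi k - 1) _ _ _ _ _ e1) => //;
      try (apply: sub => //); try lia.
  by rewrite subrK.
- have e1 : agree (lo k) (hi k + 1) X Y.
    apply: (agree_right (c := lo k) _ _ _ _ _ e) => //;
      try (apply: sub => //); try lia.
    by move: q1; rewrite subrK.
  apply: (agree_left (c := hi k) _ _ _ _ _ e1) => //;
      try (apply: sub => //); try lia.
  by move: p1; rewrite addrK.
- have e1 : agree (lo k) (hi k + 1) X Y.
    apply: (agree_right (c := lo k) _ _ _ _ _ e) => //;
      try (apply: sub => //); try lia.
    by move: p1; rewrite (_ : hi k + 2 - 1 = hi k + 1) //; lia.
  apply: (agree_right (c := lo k + 1) _ _ _ _ _ e1) => //;
      try (apply: sub => //); try lia.
  by rewrite addrK.
Qed.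
End Uniqueness.

Section Existence.
Context (K : comNzRingType).

(** Extension of a window by one term. The formula for X' d is the triple product
    formula of cross_inj solved for x, where i is the inverse of p . y. *)
Lemma chain_on_right a b c d (X X' : int -> vec3 K) (t i : K) :
  chain_on a b X -> a + 2 <= b -> d = b + 1 -> a <= c <= b ->
  (forall m, a <= m <= b -> X' m = X m) ->
  X' d = comb (t * i) (X (b - 1)) i (cross (X b) (X c)) ->
  dot (X c) (X (b - 1)) * i = 1 ->
  chain_on a d X' /\ dot (X' c) (X' d) = t.
Proof.
move=> [h1 h2] ab ed cb e ed' hi1.
have hb : cross (X (b - 2)) (X b) = X (b - 1).
  have := h1 (b - 2); rewrite subrK (_ : b - 2 + 1 = b - 1); last by lia.
  by apply; lia.
have b0 : dot (X (b - 1)) (X b) = 0 by rewrite -hb dotC dot_crossr.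
have b1 : dot (X (b - 2)) (X (b - 1)) = 0 by rewrite -hb dot_crossl.
split; last first.
  rewrite ed' e // dot_combr dot_crossr mulr0 addr0 -[RHS]mulr1 -hi1; ring.
split=> m am hm.
  have [hm'|em] : m + 2 <= b \/ m = b - 1 by lia.
    by rewrite !e ?h1 //; lia.
  rewrite {}em {m am hm} (_ : b - 1 + 2 = d) ?subrK; last by lia.
  rewrite ed' !e; [|lia..].
  rewrite cross_combr cross_crossr (dotC (X b)) b0.
  apply: vec3P => /=.
  - rewrite -[RHS]mul1r -hi1; ring.
  - rewrite -[RHS]mul1r -hi1; ring.
  - rewrite -[RHS]mul1r -hi1; ring.
have [hm'|em] : m + 3 <= b \/ m = b - 2 by lia.
  by rewrite !e ?h2 //; lia.
rewrite {}em {m am hm} (_ : b - 2 + 3 = d); last by lia.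
rewrite ed' e; last by lia.
rewrite dot_combr b1 -dot_cross hb dotC -hi1; ring.
Qed.

Lemma chain_on_left a b c d (X X' : int -> vec3 K) (t i : K) :
  chain_on a b X -> a + 2 <= b -> d = a - 1 -> a <= c <= b ->
  (forall m, a <= m <= b -> X' m = X m) ->
  X' d = comb (t * i) (X (a + 1)) i (cross (X c) (X a)) ->
  dot (X (a + 1)) (X c) * i = 1 ->
  chain_on d b X' /\ dot (X' d) (X' c) = t.
Proof.
move=> [h1 h2] ab ed cb e ed' hi1.
have ha : cross (X a) (X (a + 2)) = X (a + 1) by apply: h1; lia.
have a0 : dot (X a) (X (a + 1)) = 0 by rewrite -ha dot_crossl.
have a1 : dot (X (a + 2)) (X (a + 1)) = 0 by rewrite -ha dot_crossr.
split; last first.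
  rewrite ed' e // dotC dot_combr dot_crossl mulr0 addr0 -[RHS]mulr1 -hi1 dotC; ring.
split=> m am hm.
  have [hm'|em] : a <= m \/ m = d by lia.
    by rewrite !e ?h1 //; lia.
  rewrite {}em {m am hm} (_ : d + 2 = a + 1); last by lia.
  rewrite (_ : d + 1 = a); last by lia.
  rewrite ed' !e; [|lia..].
  rewrite cross_combl cross_crossl a0 (dotC (X c)).
  apply: vec3P => /=.
  - rewrite -[RHS]mul1r -hi1; ring.
  - rewrite -[RHS]mul1r -hi1; ring.
  - rewrite -[RHS]mul1r -hi1; ring.
have [hm'|em] : a <= m \/ m = d by lia.
  by rewrite !e ?h2 //; lia.
rewrite {}em {m am hm} (_ : d + 3 = a + 2); last by lia.
rewrite ed' e; last by lia.
rewrite dotC dot_combr a1 dotC dot_cross ha dotC -hi1; ring.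
Qed.

(** From here on the terms of a chain depend on a parameter y in D, through
    functions of a class reg closed under the ring operations. *)
Context (T : Type) (D : T -> Prop) (reg : (T -> K) -> Prop).
Hypothesis reg_const : forall k, reg (fun=> k).
Hypothesis regD : forall f g, reg f -> reg g -> reg (fun y => f y + g y).
Hypothesis regM : forall f g, reg f -> reg g -> reg (fun y => f y * g y).

Definition vreg (v : T -> vec3 K) : Prop :=
  [/\ reg (fun y => (v y).1.1), reg (fun y => (v y).1.2)
    & reg (fun y => (v y).2)].

Lemma vreg_dot u v : vreg u -> vreg v -> reg (fun y => dot (u y) (v y)).
Proof.
by move=> [? ? ?] [? ? ?]; apply: regD; [apply: regD|]; apply: regM.
Qed.

Lemma vreg_cross u v : vreg u -> vreg v -> vreg (fun y => cross (u y) (v y)).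
Proof.
move=> [? ? ?] [? ? ?].
have regB f g f' g' : reg f -> reg g -> reg f' -> reg g' ->
    reg (fun y => f y * g y - f' y * g' y).
  move=> ? ? ? ?.
  have -> : (fun y => f y * g y - f' y * g' y) =
            (fun y => f y * g y + (- 1) * (f' y * g' y)).
    by apply: funext => y; rewrite mulN1r.
  by apply: regD; [|apply: regM => //]; apply: regM.
by split; apply: regB.
Qed.

Lemma vreg_comb t u s v : reg t -> vreg u -> reg s -> vreg v ->
  vreg (fun y => comb (t y) (u y) (s y) (v y)).
Proof.
by move=> ? [? ? ?] ? [? ? ?]; split; apply: regD; apply: regM.
Qed.

Definition family a b (X : T -> int -> vec3 K) : Prop :=
  (forall m, vreg (X^~ m)) /\ forall y, D y -> chain_on a b (X y).

Lemma family_right a b c (t i : T -> K) X : family a b X -> a + 2 <= b ->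
  a <= c <= b -> reg t -> reg i ->
  (forall y, D y -> dot (X y c) (X y (b - 1)) * i y = 1) ->
  exists X', [/\ family a (b + 1) X',
    forall m y, a <= m <= b -> X' y m = X y m &
    forall y, D y -> dot (X' y c) (X' y (b + 1)) = t y].
Proof.
move=> [hr hX] ab cb rt ri hi1.
pose v y := comb (t y * i y) (X y (b - 1)) (i y) (cross (X y b) (X y c)).
pose X' y m := if m == b + 1 then v y else X y m.
have agr m y : a <= m <= b -> X' y m = X y m.
  by move=> hm; rewrite /X' (_ : (m == b + 1) = false) //; lia.
have main y : D y -> chain_on a (b + 1) (X' y) /\
    dot (X' y c) (X' y (b + 1)) = t y.
  move=> Dy; apply: (chain_on_right (hX y Dy)) (hi1 y Dy) => //.
    by move=> m; apply: agr.
  by rewrite /X' eqxx.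
exists X'; split=> //; last by move=> y /main[].
split=> [m|y /main[//]]; rewrite /X'; case: eqP => _; last exact: hr.
by apply: vreg_comb => //; [apply: regM|apply: vreg_cross].
Qed.

Lemma family_left a b c (t i : T -> K) X : family a b X -> a + 2 <= b ->
  a <= c <= b -> reg t -> reg i ->
  (forall y, D y -> dot (X y (a + 1)) (X y c) * i y = 1) ->
  exists X', [/\ family (a - 1) b X',
    forall m y, a <= m <= b -> X' y m = X y m &
    forall y, D y -> dot (X' y (a - 1)) (X' y c) = t y].
Proof.
move=> [hr hX] ab cb rt ri hi1.
pose v y := comb (t y * i y) (X y (a + 1)) (i y) (cross (X y c) (X y a)).
pose X' y m := if m == a - 1 then v y else X y m.
have agr m y : a <= m <= b -> X' y m = X y m.
  by move=> hm; rewrite /X' (_ : (m == a - 1) = false) //; lia.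
have main y : D y -> chain_on (a - 1) b (X' y) /\
    dot (X' y (a - 1)) (X' y c) = t y.
  move=> Dy; apply: (chain_on_left (hX y Dy)) (hi1 y Dy) => //.
    by move=> m; apply: agr.
  by rewrite /X' eqxx.
exists X'; split=> //; last by move=> y /main[].
split=> [m|y /main[//]]; rewrite /X'; case: eqP => _; last exact: hr.
by apply: vreg_comb => //; [apply: regM|apply: vreg_cross].
Qed.

Context (p q ip iq : nat -> T -> K).
Hypothesis regp : forall k, reg (p k).
Hypothesis regq : forall k, reg (q k).
Hypothesis regip : forall k, reg (ip k).
Hypothesis regiq : forall k, reg (iq k).
Hypothesis pV : forall k y, D y -> p k y * ip k y = 1.
Hypothesis qV : forall k y, D y -> q k y * iq k y = 1.
Hypothesis p0 : forall y, p 0 y = 1.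
Hypothesis q0 : forall y, q 0 y = 1.

(** Every choice of invertible values on the zigzag is realised, by a window
    whose terms are obtained from these values and their inverses by ring
    operations. *)
Lemma window_exists k : exists X, [/\ family (lo k) (hi k) X,
  forall y, framed (lo 0) (X y) &
  forall y, D y -> forall j, (j <= k)%N ->
    entry (X y) j (Z j) = p j y /\ entry (X y) j (Z j + 1) = q j y].
Proof.
elim: k => [|k [X [fX frX eX]]].
  (* The frame e1, e2, e3, interleaved with e1 x e2 = e3 and e2 x e3 = e1. *)
  pose X (m : int) : vec3 K :=
    if m == lo 0 then e1 K else if m == lo 0 + 1 then e3 K else
    if m == lo 0 + 2 then e2 K else if m == lo 0 + 3 then e1 K else e3 K.
  have [X0 X1 X2 X3 X4] : [/\ X (lo 0) = e1 K, X (lo 0 + 1) = e3 K,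
     X (lo 0 + 2) = e2 K, X (lo 0 + 3) = e1 K & X (lo 0 + 4) = e3 K].
    by rewrite /X; split; repeat (case: eqP => //; try lia).
  have eh : hi 0 = lo 0 + 4 by rewrite window_size; lia.
  exists (fun=> X); split=> //.
  - split=> [m|y _]; first by split; exact: reg_const.
    split=> m hm hm'.
      have [->|[->|->]] : m = lo 0 \/ m = lo 0 + 1 \/ m = lo 0 + 2 by lia.
      + by rewrite X0 X1 X2; apply: vec3P => /=; ring.
      + rewrite (_ : lo 0 + 1 + 2 = lo 0 + 3); last by lia.
        rewrite (_ : lo 0 + 1 + 1 = lo 0 + 2); last by lia.
        rewrite X1 X2 X3; apply: vec3P => /=; ring.
      + rewrite (_ : lo 0 + 2 + 2 = lo 0 + 4); last by lia.
        rewrite (_ : lo 0 + 2 + 1 = lo 0 + 3); last by lia.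
        rewrite X2 X3 X4; apply: vec3P => /=; ring.
    have [->|->] : m = lo 0 \/ m = lo 0 + 1 by lia.
      by rewrite X0 X3 /dot /=; ring.
    rewrite (_ : lo 0 + 1 + 3 = lo 0 + 4); last by lia.
    by rewrite X1 X4 /dot /=; ring.
  move=> y _ j; rewrite leqn0 => /eqP ->.
  rewrite entry_lo entry_hi p0 q0 (_ : hi 0 - 1 = lo 0 + 3); last by lia.
  rewrite eh.
  by rewrite X0 X1 X3 X4 /dot /=; split; ring.
have sz := window_size k; have [l0 h0] := window_mono (leq0n k).
have sz0 := window_size 0.
suff [X' [fX' agr pp qq]] : exists X', [/\ family (lo k.+1) (hi k.+1) X',
    forall m y, lo k <= m <= hi k -> X' y m = X y m,
    forall y, D y -> dot (X' y (lo k.+1)) (X' y (hi k.+1 - 1)) = p k.+1 y &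
    forall y, D y -> dot (X' y (lo k.+1 + 1)) (X' y (hi k.+1)) = q k.+1 y].
  exists X'; split=> // [y|y Dy j].
    by have [f0 f2 f4] := frX y; split; rewrite agr //; lia.
  rewrite leq_eqVlt ltnS => /orP[/eqP ->|jk].
    by rewrite entry_lo entry_hi pp ?qq.
  have [ljk hjk] := window_mono jk; have szj := window_size j.
  by have [] := eX y Dy j jk; rewrite !entry_lo !entry_hi !agr //; lia.
have pk y : D y -> dot (X y (lo k)) (X y (hi k - 1)) * ip k y = 1.
  move=> Dy; have [] := eX y Dy k (leqnn k).
  by rewrite entry_lo => -> _; apply: pV.
have qk y : D y -> dot (X y (lo k + 1)) (X y (hi k)) * iq k y = 1.
  move=> Dy; have [] := eX y Dy k (leqnn k).
  by rewrite entry_hi => _ ->; apply: qV.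
have [[el eh]|[el eh]|[el eh]] := window_step k; rewrite {}el {}eh.
- have [||X1 [f1 a1 d1]] := family_left fX _ _ (regq k.+1) (regiq k) qk; [lia..|].
  have [|||X2 [f2 a2 d2]] :=
    @family_left _ _ (hi k - 1) _ _ _ f1 _ _ (regp k.+1) (regip k).
  - lia.
  - lia.
  - by move=> y Dy; rewrite subrK !a1 ?pk //; lia.
  rewrite (_ : lo k - 1 - 1 = lo k - 2) in f2 d2; last by lia.
  exists X2; split=> // [m y hm|y Dy]; first by rewrite a2 ?a1 //; lia.
  by rewrite (_ : lo k - 2 + 1 = lo k - 1) ?a2 ?d1 //; lia.
- have [||X1 [f1 a1 d1]] := family_left fX _ _ (regp k.+1) (regiq k) qk; [lia..|].
  have [|||X2 [f2 a2 d2]] :=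
    @family_right _ _ (lo k) _ _ _ f1 _ _ (regq k.+1) (regip k).
  - lia.
  - lia.
  - by move=> y Dy; rewrite !a1 ?pk //; lia.
  exists X2; split=> // [m y hm|y Dy|y Dy]; first by rewrite a2 ?a1 //; lia.
    by rewrite addrK !a2 ?d1 //; lia.
  by rewrite subrK d2.
have [||X1 [f1 a1 d1]] := family_right fX _ _ (regp k.+1) (regip k) pk; [lia..|].
have [|||X2 [f2 a2 d2]] :=
    @family_right _ _ (lo k + 1) _ _ _ f1 _ _ (regq k.+1) (regiq k).
- lia.
- lia.
- by move=> y Dy; rewrite addrK !a1 ?qk //; lia.
rewrite (_ : hi k + 1 + 1 = hi k + 2) in f2 d2; last by lia.
exists X2; split=> // [m y hm|y Dy]; first by rewrite a2 ?a1 //; lia.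
by rewrite (_ : hi k + 2 - 1 = hi k + 1) ?a2 ?d1 //; lia.
Qed.
End Existence.

Section Positivity.
Context (K : numDomainType).

(** To the right of the zigzag, the frieze rule solved for its rightmost entry
    uses no subtraction, and the entries it needs are also to the right of the
    zigzag with a smaller value of P - k. Periodicity then reaches all the
    other entries. *)
Lemma chain_pos N (X : int -> vec3 K) (n : nat) : is_chain X -> (0 < n)%N ->
  (forall m, X (m + n%:Z) = X m) -> (forall P, entry X N P = 1) ->
  (forall k, (k <= N)%N -> 0 < entry X k (Z k) /\ 0 < entry X k (Z k + 1)) ->
  forall k P, (k <= N)%N -> 0 < entry X k P.
Proof.
move=> hX n0 per c1 pos.
have Z0 k : Z 0 <= Z k.
  by elim: k => // k IH; have := ZP k; lia.
(* To the right of the zigzag P - k >= Z 0 - N, so that the induction on M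
   starts with an empty range. *)
have right : forall M k P, (k <= N)%N -> Z k <= P ->
    P - k%:Z < Z 0 - N%:Z + M%:Z -> 0 < entry X k P.
  elim=> [|M IH] k P kN kP hP; first by have := Z0 k; lia.
  have [->|kN'] := eqVneq k N; first by rewrite c1 ltr01.
  case: k => [|k] in kN kP hP kN' *; first by rewrite entry0 ?ltr01.
  have [->|nP] := eqVneq P (Z k.+1); first by case: (pos k.+1).
  have [->|nP1] := eqVneq P (Z k.+1 + 1); first by case: (pos k.+1).
  have := chain_rule k (P - 2) hX; rewrite subrK => rule.
  have zk := ZP k; have zk1 := ZP k.+1.
  rewrite -(@pmulr_rgt0 _ (entry X k.+1 (P - 2))); last by apply: IH; lia.
  rewrite rule; apply: addr_gt0; first by apply: IH; lia.
  by apply: mulr_gt0; apply: IH; lia.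
move=> k P kN; pose z := absz (Z k - P)%R.
have -> : entry X k P = entry X k (P + n%:Z * z%:Z).
  rewrite /entry (_ : P + n%:Z * z%:Z - _ - 3 =
    P - k.*2%:Z - 3 + n%:Z * z%:Z); last by lia.
  by rewrite !periodicZ.
apply: (right (absz (P + n%:Z * z%:Z - k%:Z - Z 0 + N%:Z)%R).+1) => //.
  have : (z <= n * z)%N by rewrite leq_pmull.
  rewrite -PoszM /z; lia.
lia.
Qed.
End Positivity.
End Zigzag.

(** * Entries of the algebraic and of the numerical frieze *)

Section Peval.
Context (I : choiceType) (R : comNzRingType) (x : I -> R).

Definition cmeval (m : {cmonom I}) : R := \prod_(i <- finsupp m) x i ^+ m i.

Lemma cmevalE (d : {fset I}) (m : {cmonom I}) : (finsupp m `<=` d)%fset ->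
  cmeval m = \prod_(i <- d) x i ^+ m i.
Proof.
move=> md; apply: big_fset_incl => // i _.
by rewrite memNfinsupp => /eqP ->; rewrite expr0.
Qed.

Lemma cmeval_mmorphism : mmorphism cmeval.
Proof.
split=> [m k|]; last by rewrite /cmeval mdom1 big_seq_fset0.
rewrite (cmevalE (d := (finsupp m `|` finsupp k)%fset)) ?mdomD //.
rewrite (cmevalE (fsubsetUl _ (finsupp k))) (cmevalE (fsubsetUr (finsupp m) _)).
by rewrite -big_split; apply: eq_bigr => i _; rewrite cmM exprD.
Qed.

HB.instance Definition _ :=
  isMultiplicative.Build {cmonom I} R cmeval cmeval_mmorphism.

HB.instance Definition _ :=
  GRing.RMorphism.copy (peval x) (mmap idfun cmeval).

Lemma peval_var i : peval x << ucm i >> = x i.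
Proof. by rewrite /peval mmapU mul1r mdomU big_seq_fset1 cmUU. Qed.

Lemma peval_const c : peval x (malgC c) = c.
Proof. exact: (mmapC (f := idfun) (h := cmeval)). Qed.
End Peval.

Definition frieze_row0 (T : Type) (a b : int -> T) (P : int) : T :=
  if (2 %| P)%Z then a (P %/ 2)%Z else b ((P + 1) %/ 2)%Z.

Section Entries.
Context (R : realType).
Local Notation C := R[i].
Local Notation tofrac := (@FracField.tofrac (frieze_poly R)).

Definition frieze_eval (a b : int -> C) (v : frieze_var) : C :=
  match v with inl i => a i | inr i => b i end.

Definition generic_row0 : int -> frieze_poly R :=
  frieze_row0 (fun i => var_poly R (inl i)) (fun i => var_poly R (inr i)).

Lemma generic_chain : exists X : int -> vec3 (frieze_poly R), is_chain X /\
  forall P, entry X 1 P = generic_row0 P.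
Proof.
have [X [hX _ h]] := chain_exists generic_row0 0.
by exists X; split=> [|P]; [exact: hX|rewrite entry1; exact: h].
Qed.

Lemma eval_chain (X : int -> vec3 (frieze_poly R)) a b : is_chain X ->
  (forall P, entry X 1 P = generic_row0 P) ->
  forall Y : int -> vec3 C, is_chain Y ->
  (forall P, entry Y 1 P = frieze_row0 a b P) ->
  forall k P, peval (frieze_eval a b) (entry X k P) = entry Y k P.
Proof.
move=> hX eX Y hY eY k P; rewrite -(entry_map (peval (frieze_eval a b))).
apply: entry_ext => //; first exact: chain_map.
move=> Q; rewrite entry_map eX eY /generic_row0 /frieze_row0.
case: ifP => _; exact: peval_var.
Qed.

(** When all entries of row 0 are 3, row r is constant, equal to the triangular
    number (r + 2)(r + 3) / 2. *)
Lemma entry_const3 (K : comNzRingType) (X : int -> vec3 K) : is_chain X ->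
  (forall P, entry X 1 P = 3%:R) ->
  forall k P, entry X k P *+ 2 = (k.+1 * k.+2)%:R.
Proof.
move=> hX e1 k; suff : forall P, [/\ entry X k P *+ 2 = (k.+1 * k.+2)%:R,
   entry X k.+1 P *+ 2 = (k.+2 * k.+3)%:R
   & entry X k.+2 P *+ 2 = (k.+3 * k.+4)%:R] by move=> h P; case: (h P).
elim: k => [|k IH] P.
  by split; rewrite ?entry0 ?entry_2 // ?e1 ?entry0 //; ring.
have [_ h1 h2] := IH P; split=> //.
rewrite (_ : P = P - 6 + 6); last by lia.
rewrite entry_rec // !e1 mulrnDl mulrnBl -!mulrnAr.
have [-> _ _] := IH (P - 6); have [_ -> _] := IH (P - 6 + 2).
have [_ _ ->] := IH (P - 6 + 4).
ring.
Qed.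

(** Specialising all variables to 3 shows that no division by zero occurs in
    the definition of the algebraic frieze. *)
Lemma generic_neq0 (X : int -> vec3 (frieze_poly R)) : is_chain X ->
  (forall P, entry X 1 P = generic_row0 P) ->
  forall k P, entry X k P != 0.
Proof.
move=> hX eX k P; apply/negP => /eqP e0.
have [Y [hY _ eY]] := chain_exists (fun=> 3%:R : C) 0.
have eY1 Q : entry Y 1 Q = 3%:R by rewrite entry1 eY.
have := entry_const3 hY eY1 k P.
rewrite -(@eval_chain _ (fun=> 3%:R) (fun=> 3%:R) hX eX) //; last first.
  by move=> Q; rewrite eY1 /frieze_row0; case: ifP.
by rewrite e0 rmorph0 mul0rn => /eqP; rewrite eq_sym pnatr_eq0.
Qed.

Lemma solve_rule (F : fieldType) (x y z u w : F) : u != 0 ->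
  x * y = z + u * w -> (x * y - z) / u = w.
Proof. by move=> u0 ->; rewrite addrAC subrr add0r mulrC mulKf. Qed.

(** As long as the entries are nonzero, the recursion of alg_rows, which divides
    by an entry two rows above, computes the entries of the chain. *)
Lemma alg_rows_chain (X : int -> vec3 (frieze_field R)) : is_chain X ->
  (forall P, entry X 1 P = alg_row0 R P) -> (forall k P, entry X k P != 0) ->
  forall r P, (alg_rows R r).1 P = entry X r P /\
    (alg_rows R r).2 P = entry X r.+1 P.
Proof.
move=> hX eX nz; elim=> [|r IH] P.
  by split; [rewrite entry0|rewrite eX].
have := IH P; have := IH (P - 2); have := IH (P - 1) => /=.
case: (alg_rows R r) => u v /= [_ v1] [u2 v2] [_ v0]; split; first exact: v0.
rewrite v1 u2 v2 v0; apply: solve_rule; first exact: nz.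
have := chain_rule r (P - 2) hX; rewrite subrK.
by have -> : P - 2 + 1 = P - 1 by lia.
Qed.

Lemma alg_entryE (X : int -> vec3 (frieze_poly R)) : is_chain X ->
  (forall P, entry X 1 P = generic_row0 P) ->
  forall (r : nat) P, tofrac (entry X r.+1 P) = alg_entry R r P.
Proof.
move=> hX eX r P.
have hY := chain_map tofrac hX.
have [|k Q|_ e] := alg_rows_chain hY _ _ r P.
- move=> Q; rewrite (entry_map tofrac) eX /generic_row0 /frieze_row0 /alg_row0.
  by case: ifP.
- by rewrite (entry_map tofrac) tofrac_eq0; exact: generic_neq0.
by rewrite -(entry_map tofrac) -e.
Qed.

(** The entries of the algebraic frieze are the images of the products of a
    chain over the polynomial ring, and evaluation turns these into products of
    any chain with the right row 0. *)
Lemma num_entry_chain a b (Y : int -> vec3 C) : is_chain Y ->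
  (forall P, entry Y 1 P = frieze_row0 a b P) ->
  forall (r : nat) P, num_entry a b r P = entry Y r.+1 P.
Proof.
move=> hY eY r P; have [X [hX eX]] := generic_chain.
rewrite /num_entry; have -> : entry_poly R r P = entry X r.+1 P.
  have := alg_entryE hX eX r P => e.
  apply/eqP; rewrite -tofrac_eq e; apply/eqP.
  exact: (xgetPex (P := [set p | tofrac p = alg_entry R r P]%classic) 0
    (ex_intro _ (entry X r.+1 P) e)).
exact: (eval_chain hX eX hY eY).
Qed.
End Entries.

(** * Regular functions *)

Section Regular.
Context (K : fieldType) (m : nat).
Local Notation P := {malg K[{cmonom 'I_m}]}.
Implicit Types (x y : 'rV[K]_m) (f g : 'rV[K]_m -> K).

Lemma mvevalD (p q : P) x : mveval (p + q) x = mveval p x + mveval q x.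
Proof. exact: (rmorphD (peval (x ord0))). Qed.

Lemma mvevalM (p q : P) x : mveval (p * q) x = mveval p x * mveval q x.
Proof. exact: (rmorphM (peval (x ord0))). Qed.

Lemma mveval_const c x : mveval (malgC c : P) x = c.
Proof. exact: peval_const. Qed.

Lemma mveval1 x : mveval (1 : P) x = 1.
Proof. exact: mveval_const. Qed.

Lemma mveval_var i x : mveval (<< ucm i >> : P) x = x ord0 i.
Proof. exact: peval_var. Qed.

(** Regular functions given by one quotient on the whole of D; unlike general
    regular functions they are visibly closed under the ring operations. *)
Definition quotient_on (D : set 'rV[K]_m) f : Prop :=
  exists p q : P, forall y, D y -> mveval q y != 0 /\ f y = mveval p y / mveval q y.

Context (D : set 'rV[K]_m).

Lemma quotient_poly (p : P) : quotient_on D (mveval p).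
Proof. by exists p, 1 => y _; rewrite mveval1 divr1 oner_neq0. Qed.

Lemma quotient_const c : quotient_on D (fun=> c).
Proof.
have [p [q h]] := quotient_poly (malgC c); exists p, q => y Dy.
by have [? <-] := h y Dy; rewrite mveval_const.
Qed.

Lemma quotient_intro (p q : P) y (a b c : K) : mveval p y = a ->
  mveval q y = b -> b != 0 -> c = a / b ->
  mveval q y != 0 /\ c = mveval p y / mveval q y.
Proof. by move=> -> ->. Qed.

Lemma quotientD f g : quotient_on D f -> quotient_on D g ->
  quotient_on D (fun y => f y + g y).
Proof.
move=> [p [q h]] [p' [q' h']]; exists (p * q' + p' * q), (q * q') => y Dy.
have [q0 ->] := h y Dy; have [q0' ->] := h' y Dy.
apply: (quotient_intro _ (mvevalM _ _ _)); last exact: addf_div.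
  exact: etrans (mvevalD _ _ _) (congr2 _ (mvevalM _ _ _) (mvevalM _ _ _)).
exact: mulf_neq0.
Qed.

Lemma quotientM f g : quotient_on D f -> quotient_on D g ->
  quotient_on D (fun y => f y * g y).
Proof.
move=> [p [q h]] [p' [q' h']]; exists (p * p'), (q * q') => y Dy.
have [q0 ->] := h y Dy; have [q0' ->] := h' y Dy.
apply: (quotient_intro (mvevalM _ _ _) (mvevalM _ _ _)).
  exact: mulf_neq0.
exact: mulf_div.
Qed.

Lemma quotientV f : quotient_on D f -> (forall y, D y -> f y != 0) ->
  quotient_on D (fun y => (f y)^-1).
Proof.
move=> [p [q h]] f0; exists q, p => y Dy.
have [q0 e] := h y Dy; have := f0 y Dy.
by rewrite e invf_div mulf_eq0 invr_eq0 negb_or => /andP[].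
Qed.

Lemma quotient_regular f : quotient_on D f -> regular_on D f.
Proof.
move=> [p [q h]] x Dx; exists p, q; split; first by have [] := h x Dx.
by move=> y /h[].
Qed.
End Regular.

(** * Friezes as points *)

Section FriezePoints.
Context (R : realType).
Local Notation C := R[i].
Implicit Types (a b : int -> C) (Y : int -> vec3 C).

Lemma row0_even (T : Type) (a b : int -> T) i : frieze_row0 a b (2 * i)%R = a i.
Proof. by rewrite /frieze_row0 dvdz_mulr // mulKz. Qed.

Lemma row0_odd (T : Type) (a b : int -> T) i : frieze_row0 a b (2 * i - 1) = b i.
Proof.
rewrite /frieze_row0 subrK mulKz // (_ : (2 %| 2 * i - 1)%Z = false) //.
by lia.
Qed.

Lemma row0P (T : Type) (c : int -> T) P :
  frieze_row0 (fun i => c (2 * i)) (fun i => c (2 * i - 1)) P = c P.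
Proof. rewrite /frieze_row0; case: ifP => h; congr c; lia. Qed.

Lemma closed_friezeE N a b Y : (0 < N)%N -> is_chain Y ->
  (forall P, entry Y 1 P = frieze_row0 a b P) ->
  closed_frieze N.+3 a b <-> forall m, Y (m + N.+3.*2%:Z) = Y m.
Proof.
move=> N0 hY eY; have E := num_entry_chain hY eY.
have e1 : (N.+3 - 4).+1 = N by lia.
have e2 : (N.+3 - 3).+1 = N.+1 by lia.
have e3 : (N.+3 - 2).+1 = N.+2 by lia.
split=> [[]|per]; last first.
  by split=> P; rewrite E ?e1 ?e2 ?e3; have [] := periodic_closed hY per P.
move=> c1 c2 c3; apply: closed_periodic => // P.
- by rewrite -e1 -E.
- by rewrite -e2 -E.
- by rewrite -e3 -E.
Qed.

Lemma row0_periodic n a b Y : (forall P, entry Y 1 P = frieze_row0 a b P) ->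
  (forall m, Y (m + n.*2%:Z) = Y m) ->
  (forall i, a (i + n%:Z) = a i) /\ (forall i, b (i + n%:Z) = b i).
Proof.
move=> eY per.
have per1 P : entry Y 1 (P + n.*2%:Z) = entry Y 1 P.
  rewrite !entry1 per (_ : P + n.*2%:Z - 5 = P - 5 + n.*2%:Z) ?per //; lia.
split=> i.
  by rewrite -!(@row0_even _ a b) -!eY -[RHS]per1; congr (entry _ _ _); lia.
by rewrite -!(@row0_odd _ a b) -!eY -[RHS]per1; congr (entry _ _ _); lia.
Qed.

Lemma periodic_seqE n (c : int -> C) : (0 < n)%N ->
  (forall i, c (i + n%:Z) = c i) ->
  periodic_seq (\row_(i < n) c i.+1) = c.
Proof.
move=> n0 per; apply/funext => i; rewrite /periodic_seq.
have mb : 0 <= ((i - 1) %% n)%Z < n by rewrite modz_ge0 ?ltz_pmod //; lia.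
case: insubP => [j _ ej|]; last by rewrite -ltnNge; lia.
rewrite /= mxE -(periodicZ per j.+1 ((i - 1) %/ n)%Z); congr c.
have := divz_eq (i - 1) n; rewrite ej; lia.
Qed.

Lemma entry_at_frieze_point n a b r P : (0 < n)%N ->
  (forall i, a (i + n%:Z) = a i) -> (forall i, b (i + n%:Z) = b i) ->
  entry_at (frieze_point n a b) r P = num_entry a b r P.
Proof.
move=> n0 pa pb.
by rewrite /entry_at /frieze_point row_mxKl row_mxKr !periodic_seqE.
Qed.

(** Each entry is polynomial in the 2n numbers of a point, because the chain
    with this periodic row 0 exists over the ring of polynomials in 2n
    variables. *)
Lemma entry_at_poly n (r : nat) P : exists p : {malg C[{cmonom 'I_(n + n)}]},
  forall x : 'rV[C]_(n + n), mveval p x = entry_at x r P.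
Proof.
pose A := {malg C[{cmonom 'I_(n + n)}]}.
pose v (s : 'I_n -> 'I_(n + n)) (i : int) : A :=
  oapp (fun j => << ucm (s j) >>) 0 (insub (absz ((i - 1) %% n)%Z)).
have [X [hX _ eX]] :=
  chain_exists (frieze_row0 (v (@lshift n n)) (v (@rshift n n))) 0.
exists (entry X r.+1 P) => x.
have hY := chain_map (peval (x ord0)) hX.
rewrite /entry_at (num_entry_chain (a := periodic_seq (lsubmx x)) hY).
  exact: (esym (entry_map _ _ _ _)).
move=> Q; rewrite (entry_map (peval (x ord0))) entry1 eX /frieze_row0.
case: ifP => _; rewrite /v /periodic_seq; case: insubP => [j _ _|_] /=;
  by rewrite ?(rmorph0 (peval (x ord0))) // peval_var mxE.
Qed.
End FriezePoints.

(** * From coordinates to friezes and back *)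

Section Coordinates.
Context (R : realType).
Local Notation C := R[i].

(** The zigzag is prolonged by vertical steps through the rows of ones above
    and below the frieze, with a shift of the row index by one. *)
Lemma zigzag_extend m (zeta : 'I_m -> int) : (0 < m)%N -> double_zigzag zeta ->
  exists Z : nat -> int, (forall r : 'I_m, Z r.+1 = zeta r) /\
    forall k, Z k <= Z k.+1 <= Z k + 2.
Proof.
move=> m0 zz.
have lt k : (minn k.-1 m.-1 < m)%N by lia.
exists (fun k => zeta (Ordinal (lt k))); split=> [r|k].
  congr zeta; apply: val_inj => /=; have := ltn_ord r; lia.
have [e|e] : Ordinal (lt k.+1) = Ordinal (lt k) \/
    Ordinal (lt k.+1) = (Ordinal (lt k)).+1 :> nat.
  have [e|e] : minn k m.-1 = minn k.-1 m.-1 \/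
      minn k m.-1 = (minn k.-1 m.-1).+1 by lia.
    by left; apply: val_inj.
  by right.
- by rewrite e; lia.
have := zz _ _ e; rewrite !inE => /or3P[] /eqP ->; lia.
Qed.

(** The coordinates x and y are distinguished by the parity of the index; in the
    windows, what matters is which entry of the pair is on the left. *)
Definition left_coord m (zeta : 'I_m -> int) (y : 'rV[C]_(m + m))
    (r : 'I_m) : C :=
  y ord0 (if (2 %| zeta r)%Z then lshift m r else rshift m r).
Definition right_coord m (zeta : 'I_m -> int) (y : 'rV[C]_(m + m))
    (r : 'I_m) : C :=
  y ord0 (if (2 %| zeta r)%Z then rshift m r else lshift m r).

Lemma left_zigzag n (zeta : 'I_(n - 4) -> int) (x : 'rV[C]_(n + n)) r :
  left_coord zeta (zigzag_coords zeta x) r = entry_at x r (zeta r).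
Proof.
rewrite /left_coord /zigzag_coords; case: ifP => h.
  by rewrite row_mxEl mxE /x_index h.
by rewrite row_mxEr mxE /y_index h.
Qed.

Lemma right_zigzag n (zeta : 'I_(n - 4) -> int) (x : 'rV[C]_(n + n)) r :
  right_coord zeta (zigzag_coords zeta x) r = entry_at x r (zeta r + 1).
Proof.
rewrite /right_coord /zigzag_coords; case: ifP => h.
  by rewrite row_mxEr mxE /y_index h.
by rewrite row_mxEl mxE /x_index h.
Qed.

Lemma coords_ext m (zeta : 'I_m -> int) (y y' : 'rV[C]_(m + m)) :
  (forall r, left_coord zeta y r = left_coord zeta y' r) ->
  (forall r, right_coord zeta y r = right_coord zeta y' r) -> y = y'.
Proof.
move=> hl hr; apply/rowP => j; rewrite -(splitK j).
case: (fintype.split j) => r /=; have := hl r; have := hr r;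
  by rewrite /left_coord /right_coord; case: ifP.
Qed.

Lemma zigzag_coords_poly n (zeta : 'I_(n - 4) -> int) (j : 'I_(n - 4 + (n - 4))) :
  exists p : {malg C[{cmonom 'I_(n + n)}]},
  forall x : 'rV[C]_(n + n), mveval p x = zigzag_coords zeta x ord0 j.
Proof.
rewrite -(splitK j); case: (fintype.split j) => r /=.
  have [p h] := entry_at_poly R n r (x_index (zeta r)).
  by exists p => x; rewrite h row_mxEl mxE.
have [p h] := entry_at_poly R n r (y_index (zeta r)).
by exists p => x; rewrite h row_mxEr mxE.
Qed.

(** Prescribed entries indexed as the prolonged zigzag: the value 1 is taken in
    both rows of ones. *)
Definition padded m (c : 'I_m -> C) (k : nat) : C :=
  if k is k'.+1 then oapp c 1 (insub k') else 1.

Lemma padded_ord m (c : 'I_m -> C) (r : 'I_m) : padded c r.+1 = c r.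
Proof. by rewrite /padded valK. Qed.

Lemma padded_ge m (c : 'I_m -> C) k : (m < k)%N -> padded c k = 1.
Proof.
case: k => // k mk; rewrite /padded insubF //.
by apply/negbTE; rewrite -leqNgt.
Qed.

Lemma paddedP m (c : 'I_m -> C) k :
  padded c k = 1 \/ exists2 r : 'I_m, k = r.+1 & padded c k = c r.
Proof.
case: k => [|k]; first by left.
case: (ltnP k m) => km; last by left; rewrite padded_ge.
by right; exists (Ordinal km); rewrite // -padded_ord.
Qed.

Section Construction.
Context (N : nat) (N2 : (2 <= N)%N).
Local Notation n := N.+3.
Local Notation m := (n - 4)%N.
Context (zeta : 'I_m -> int) (Z : nat -> int).
Hypothesis Zzeta : forall r : 'I_m, Z r.+1 = zeta r.
Hypothesis ZP : forall k, Z k <= Z k.+1 <= Z k + 2.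
Local Notation p k y := (padded (left_coord zeta y) k).
Local Notation q k y := (padded (right_coord zeta y) k).
Local Notation T := (torus C (m + m)).

Let eb : hi Z N = lo Z N + N.+2.*2%:Z.
Proof. by rewrite window_size; lia. Qed.

Definition has_coords (Y : int -> vec3 C) y := forall k, (k <= N)%N ->
  entry Y k (Z k) = p k y /\ entry Y k (Z k + 1) = q k y.

(** The last window, in the lower row of ones, has 2n - 1 terms, and the two
    entries 1 on it are what makes its periodic extension a chain. *)
Lemma frieze_from_coords : exists Y : 'rV[C]_(m + m) -> int -> vec3 C,
  (forall j, vreg (quotient_on T) (fun y => Y y j)) /\
  forall y, T y -> [/\ is_chain (Y y),
    forall j, Y y (j + n.*2%:Z) = Y y j, framed (lo Z 0) (Y y) &
    has_coords (Y y) y].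
Proof.
have nz y (c : 'I_m -> C) k : T y -> (forall r, exists j, c r = y ord0 j) ->
    padded c k != 0.
  move=> Ty hc; case: (paddedP c k) => [->|[r _ ->]]; first exact: oner_neq0.
  by have [j ->] := hc r.
have nzp y k : T y -> p k y != 0 by move=> Ty; apply: nz Ty _ => r; eexists.
have nzq y k : T y -> q k y != 0 by move=> Ty; apply: nz Ty _ => r; eexists.
have reg_coord (j : 'I_(m + m)) : quotient_on T (fun y => y ord0 j).
  have [P [Q h]] :=
    quotient_poly T (<< ucm j >> : {malg C[{cmonom 'I_(m + m)}]}).
  by exists P, Q => y /h[? <-]; rewrite mveval_var.
have regp k : quotient_on T (fun y => p k y).
  case: k => [|k]; first exact: quotient_const.
  rewrite /padded; case: insubP => [r _ _|_] /=; first exact: reg_coord.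
  exact: quotient_const.
have regq k : quotient_on T (fun y => q k y).
  case: k => [|k]; first exact: quotient_const.
  rewrite /padded; case: insubP => [r _ _|_] /=; first exact: reg_coord.
  exact: quotient_const.
have [X [[rX hX] frX eX]] := window_exists ZP
  (quotient_const T) (@quotientD _ _ T) (@quotientM _ _ T) regp regq
  (fun k => quotientV (regp k) (nzp^~ k)) (fun k => quotientV (regq k) (nzq^~ k))
  (fun k y Ty => mulfV (nzp y k Ty)) (fun k y Ty => mulfV (nzq y k Ty))
  (fun=> erefl) (fun=> erefl) N.
exists (fun y => close_up N (lo Z N) (hi Z N) (X y)); split.
  move=> j; rewrite /close_up /=; case: (_ <= hi Z N); first exact: rX.
  by apply: (vreg_cross (quotient_const T) (@quotientD _ _ T)
    (@quotientM _ _ T)); exact: rX.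
move=> y Ty; have e := eX y Ty.
have [pN qN] := e N (leqnn N).
rewrite padded_ge in pN; last by lia.
rewrite padded_ge in qN; last by lia.
rewrite entry_lo in pN; rewrite entry_hi in qN.
have [h1 h2 h3] := chain_close eb (hX y Ty) pN qN.
have sub k j : (k <= N)%N -> lo Z k <= j <= hi Z k ->
    close_up N (lo Z N) (hi Z N) (X y) j = X y j.
  by move=> /(window_mono ZP)[? ?] ?; apply: h3; lia.
split=> //.
  have [f0 f2 f4] := frX y; have sz := window_size Z 0.
  by split; rewrite (sub 0%N) //; lia.
move=> k kN; have := e k kN; have sz := window_size Z k.
by rewrite !(entry_lo Z) !(entry_hi Z) !(sub k) //; lia.
Qed.

(** The last window covers all but one term of a period. *)
Lemma coords_determine (X Y : int -> vec3 C) y : T y ->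
  is_chain X -> is_chain Y ->
  (forall j, X (j + n.*2%:Z) = X j) -> (forall j, Y (j + n.*2%:Z) = Y j) ->
  framed (lo Z 0) X -> framed (lo Z 0) Y ->
  has_coords X y -> has_coords Y y -> X =1 Y.
Proof.
move=> Ty hX hY pX pY [X0 X2 X4] [Y0 Y2 Y4] cX cY.
have sz := window_size Z 0.
apply: (periodic_agree eb) => //; apply: (window_unique ZP) => //.
  move=> j hj; have [->|[->|[->|[->|->]]]] : j = lo Z 0 \/ j = lo Z 0 + 1 \/
      j = lo Z 0 + 2 \/ j = lo Z 0 + 3 \/ j = lo Z 0 + 4 by lia.
  - by rewrite X0 Y0.
  - rewrite -(@chain_cross _ X (lo Z 0) _ (lo Z 0 + 2)) //.
    by rewrite -(@chain_cross _ Y (lo Z 0) _ (lo Z 0 + 2)) // X0 Y0 X2 Y2.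
  - by rewrite X2 Y2.
  - rewrite -(@chain_cross _ X (lo Z 0 + 2) _ (lo Z 0 + 4)) //; [|lia..].
    rewrite -(@chain_cross _ Y (lo Z 0 + 2) _ (lo Z 0 + 4)) //; [|lia..].
    by rewrite X2 Y2 X4 Y4.
  - by rewrite X4 Y4.
move=> k kN; have [-> ->] := cX k kN; have [-> ->] := cY k kN; split=> //.
  case: (paddedP (left_coord zeta y) k) => [->|[r _ ->]]; last exact: Ty.
  exact: oner_neq0.
case: (paddedP (right_coord zeta y) k) => [->|[r _ ->]]; last exact: Ty.
exact: oner_neq0.
Qed.

Definition point_of (Y : int -> vec3 C) : 'rV[C]_(n + n) :=
  frieze_point n (fun i => entry Y 1 (2 * i)) (fun i => entry Y 1 (2 * i - 1)).

Lemma frieze_chain x : friezes R n x -> exists Y, [/\ is_chain Y,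
  forall j, Y (j + n.*2%:Z) = Y j, framed (lo Z 0) Y & x = point_of Y].
Proof.
move=> [a [b [cl ->]]].
have [Y [hY fY eY]] := chain_exists (frieze_row0 a b) (lo Z 0).
have eY1 P : entry Y 1 P = frieze_row0 a b P by rewrite entry1 eY.
have [per _] := closed_friezeE (ltnW N2) hY eY1.
exists Y; split=> //; first exact: per.
congr frieze_point; apply/funext => i; rewrite eY1.
  by rewrite row0_even.
by rewrite row0_odd.
Qed.

Lemma chain_frieze Y : is_chain Y -> (forall j, Y (j + n.*2%:Z) = Y j) ->
  exists a b, [/\ closed_frieze n a b, point_of Y = frieze_point n a b,
    forall (r : nat) P, num_entry a b r P = entry Y r.+1 P &
    forall (r : nat) P, entry_at (point_of Y) r P = entry Y r.+1 P].
Proof.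
move=> hY per.
have eY P : entry Y 1 P = frieze_row0 (fun i => entry Y 1 (2 * i))
    (fun i => entry Y 1 (2 * i - 1)) P.
  by rewrite row0P.
have [pa pb] := row0_periodic eY per.
exists (fun i => entry Y 1 (2 * i)), (fun i => entry Y 1 (2 * i - 1)).
split=> //.
- by apply/(closed_friezeE (ltnW N2) hY eY).
- exact: num_entry_chain.
by move=> r P; rewrite entry_at_frieze_point //; apply: num_entry_chain.
Qed.

Lemma has_coordsP Y y : is_chain Y -> (forall j, Y (j + n.*2%:Z) = Y j) ->
  has_coords Y y <-> zigzag_coords zeta (point_of Y) = y.
Proof.
move=> hY per; have [a [b [_ _ _ E]]] := chain_frieze hY per.
split=> [h|<- k kN].
  apply: (coords_ext (zeta := zeta)) => r.
    have [] := h r.+1; first by have := ltn_ord r; lia.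
    by rewrite left_zigzag E !padded_ord !Zzeta => ? ?.
  have [] := h r.+1; first by have := ltn_ord r; lia.
  by rewrite right_zigzag E !padded_ord !Zzeta => ? ?.
case: k kN => [|k] kN; first by rewrite !entry0.
have [km|km] := ltnP k m.
  pose r := Ordinal km; rewrite -[k]/(val r).
  by rewrite !padded_ord left_zigzag right_zigzag !E Zzeta.
have -> : k.+1 = N by lia.
have c1 P := (periodic_closed hY per P).
rewrite !padded_ge; [|lia..].
by have [-> _ _] := c1 (Z N); have [-> _ _] := c1 (Z N + 1).
Qed.

End Construction.
End Coordinates.

(** * Regularity of the coordinates and of their inverse *)

Section Regularity.
Local Open Scope classical_set_scope.
Context (R : realType).
Local Notation C := R[i].

(** The complement is the zero locus of the product of the coordinates, which
    are polynomial functions of the point. *)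
Lemma zariski_open_torus n (zeta : 'I_(n - 4) -> int) :
  zariski_open_in (friezes R n)
    (friezes R n `&` zigzag_coords zeta @^-1` torus C (n - 4 + (n - 4))).
Proof.
have [p hp] := choice (zigzag_coords_poly R zeta).
exists [set x | exists j, zigzag_coords zeta x ord0 j = 0]; split.
  exists [set \prod_j p j]; apply/seteqP; split=> x /=.
    move=> [j xj] _ ->; rewrite /mveval (rmorph_prod (peval (x ord0))).
    by apply/eqP/prodf_eq0; exists j => //; apply/eqP; exact: etrans (hp j x) xj.
  move=> /(_ _ erefl); rewrite /mveval (rmorph_prod (peval (x ord0))).
  move=> /eqP/prodf_eq0[j _ /eqP xj].
  by exists j; exact: etrans (esym (hp j x)) xj.
apply/seteqP; split=> x /= [fx].
  by move=> tx; split=> // -[j] /eqP; apply/negP; exact: tx.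
by move=> nx; split=> // j; apply/negP => /eqP xj; apply: nx; exists j.
Qed.

Lemma closed_entry_at N (a b : int -> C) (r : nat) P : (0 < N)%N ->
  closed_frieze N.+3 a b ->
  entry_at (frieze_point N.+3 a b) r P = num_entry a b r P.
Proof.
move=> N0 cl; have [X [hX _ eX]] := chain_exists (frieze_row0 a b) 0.
have eX1 Q : entry X 1 Q = frieze_row0 a b Q by rewrite entry1 eX.
have /(closed_friezeE N0 hX eX1) per := cl.
by have [pa pb] := row0_periodic eX1 per; rewrite entry_at_frieze_point.
Qed.

Lemma point_of_regular N m (D : set 'rV[C]_m) (Y : 'rV[C]_m -> int -> vec3 C) :
  (forall j, vreg (quotient_on D) (fun y => Y y j)) ->
  forall j, regular_on D (fun y => point_of N (Y y) ord0 j).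
Proof.
move=> rY j; apply: quotient_regular.
have rdot s t : quotient_on D (fun y => entry (Y y) s t).
  apply: (vreg_dot (@quotientD _ _ D) (@quotientM _ _ D)); exact: rY.
rewrite -(splitK j); case: (fintype.split j) => r /=.
  rewrite (_ : (fun y => _) = (fun y => entry (Y y) 1 (2 * r.+1%:Z))) //.
  by apply/funext => y; rewrite /point_of /frieze_point row_mxEl mxE.
rewrite (_ : (fun y => _) = (fun y => entry (Y y) 1 (2 * r.+1%:Z - 1))) //.
by apply/funext => y; rewrite /point_of /frieze_point row_mxEr mxE.
Qed.

End Regularity.

(** * The theorem *)

Theorem theorem2 (R : realType) (n : nat) (n_ge5 : (5 <= n)%N)
    (zeta : 'I_(n - 4) -> int) (zetaP : double_zigzag zeta) :
  (exists U : set 'rV[R[i]]_(n + n),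
     zariski_open_in (friezes R n) U /\
     biregular U (torus R[i] ((n - 4) + (n - 4))) (zigzag_coords zeta)) /\
  set_bij (pos_friezes R n) (positive_orthant R ((n - 4) + (n - 4)))
    (zigzag_coords zeta).
Proof.
have [N N2 en] : exists2 N, (2 <= N)%N & n = N.+3 by exists (n - 3)%N; lia.
subst n; have [|Z [Zz ZP]] := zigzag_extend _ zetaP; first by lia.
have [Y [rY hY]] := frieze_from_coords R N2 zeta ZP.
pose g y := point_of N (Y y); set T := torus _ _; set f := zigzag_coords zeta.
have gK y : T y -> f (g y) = y.
  move=> Ty; have [h1 h2 _ h4] := hY y Ty.
  exact: (has_coordsP N2 Zz _ h1 h2).1.
have gF y : T y -> friezes R _ (g y).
  move=> Ty; have [h1 h2 _ _] := hY y Ty.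
  have [a [b [cl e _ _]]] := chain_frieze N2 h1 h2.
  by exists a, b; split; [exact: cl|exact: e].
have fK x : friezes R _ x -> T (f x) -> g (f x) = x.
  move=> /(frieze_chain N2 Z)[X [X1 X2 X3 ->]] Tx.
  have [h1 h2 h3 h4] := hY _ Tx; rewrite /g; congr point_of.
  apply/funext; apply: (coords_determine (zeta := zeta) N2 ZP Tx) => //.
  by apply: (has_coordsP N2 Zz _ X1 X2).2.
split.
  (* The open set is the locus where no coordinate vanishes. *)
  exists (friezes R N.+3 `&` f @^-1` T)%classic; split.
    exact: zariski_open_torus.
  split.
    split=> [x [] //|j x [fx Tx]].
    have [p hp] := zigzag_coords_poly R zeta j.
    have [P [Q h]] := quotient_poly (setT : set 'rV[R[i]]_(N.+3 + N.+3)) p.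
    exists P, Q; split; first by have [] := h x I.
    by move=> z _ _; have [_ <-] := h z I; rewrite hp.
  exists g; split.
  - split=> [y Ty|j]; last exact: point_of_regular.
    by split; [exact: gF|rewrite /preimage /= gK].
  - by move=> x; rewrite inE => -[fx Tx]; apply: fK.
  - by move=> y; rewrite inE => Ty; apply: gK.
have posT y : positive_orthant R _ y -> T y.
  by move=> py j; rewrite gt_eqF.
have posF x : pos_friezes R N.+3 x -> friezes R _ x /\ positive_orthant R _ (f x).
  move=> [a [b [cl pos ->]]]; split=> [|j]; first by exists a, b.
  rewrite -(splitK j); case: (fintype.split j) => r /=.
    rewrite row_mxEl mxE (@closed_entry_at _ _ _ _ _ _ (ltnW N2) cl); exact: pos.
  rewrite row_mxEr mxE (@closed_entry_at _ _ _ _ _ _ (ltnW N2) cl); exact: pos.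
split.
- by move=> x /posF[].
- move=> x y; rewrite !inE => /posF[fx px] /posF[fy py] e.
  by rewrite -(fK x) ?e ?fK //; apply: posT.
move=> y py; have Ty := posT y py; exists (g y); last exact: gK.
have [h1 h2 _ h4] := hY y Ty.
have [a [b [cl e e1 _]]] := chain_frieze N2 h1 h2.
exists a, b; split=> // r P; rewrite e1.
have cN Q := periodic_closed h1 h2 Q.
apply: (chain_pos ZP h1 _ h2 (N := N)) => //.
- by move=> Q; have [-> _ _] := cN Q.
- move=> k kN; have [-> ->] := h4 k kN; split.
    case: (paddedP (left_coord zeta y) k) => [->|[s _ ->]]; last exact: py.
    exact: ltr01.
  case: (paddedP (right_coord zeta y) k) => [->|[s _ ->]]; last exact: py.
  exact: ltr01.
by have := ltn_ord r; lia.
Qed.
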